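(* Let $(S_n)_{n\ge 1}$ be the elephant random walk with memory parameter $p$ and first-step parameter $q\in[0,1]$, and let $a_n$, $v_n$ be the associated normalizing sequences (all defined in the context). There exist an absolute constant $C>0$ and, for each $p$, a constant $C_p>0$ depending only on $p$, such that the following hold. (i) If $0<p<1/2$, then for all $n\ge 2$, $$\|F_{a_nS_n/\sqrt{v_n}}-\Phi\|_1\le C\,\frac{\log n}{\sqrt n}.$$ (ii) If $1/2<p<3/4$, then for all $n\ge 2$, $$\|F_{a_nS_n/\sqrt{v_n}}-\Phi\|_1\le C_p\,\frac{\log n}{\sqrt{n^{3-4p}}}.$$ (iii) If $p=3/4$, then for all $n\ge 3$, $$\|F_{a_nS_n/\sqrt{v_n}}-\Phi\|_1\le C\,\frac{\log\log n}{\sqrt{\log n}}.$$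
   Context: Rademacher distribution: for $r\in[0,1]$, a random variable has the Rademacher distribution $\mathcal R(r)$ if it equals $+1$ with probability $r$ and $-1$ with probability $1-r$. Elephant random walk: let $p,q\in[0,1]$. The first step $\eta_1$ has distribution $\mathcal R(q)$. For $n\ge1$, $\eta_{n+1}=\alpha_n\eta_{\beta_n}$, where $\alpha_n$ has distribution $\mathcal R(p)$, $\beta_n$ is uniformly distributed on $\{1,\dots,n\}$, and $\alpha_n$, $\beta_n$ and $(\eta_1,\dots,\eta_n)$ are mutually independent. The position is $S_0=0$ and $S_n=\sum_{i=1}^n\eta_i$ for $n\ge1$. The number $p$ is called the memory parameter. Normalizing sequences: $a_1=1$, and for $n\ge2$, $a_n=\dfrac{\Gamma(n)\Gamma(2p)}{\Gamma(n+2p-1)}$, where $\Gamma$ is the Gamma function; $v_n=\sum_{i=1}^n a_i^2$. Wasserstein-1 distance: for a real random variable $X$ with distribution function $F_X$, and $\Phi$ the standard normal distribution function, $\|F_X-\Phi\|_1=\int_{-\infty}^{+\infty}|F_X(x)-\Phi(x)|\,dx$. An absolute constant does not depend on $n$, $p$ or $q$; a constant depending only on $p$ does not depend on $n$ or $q$. *)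

(* Defs.v *)
From HB Require Import structures.
From mathcomp Require Import all_boot all_order all_algebra.
From mathcomp Require Import all_classical all_reals all_analysis.
From mathcomp Require Import measurable_realfun.

Set Implicit Arguments.
Unset Strict Implicit.
Unset Printing Implicit Defensive.

Import Order.TTheory GRing.Theory Num.Theory.
Import numFieldNormedType.Exports.

Local Open Scope classical_set_scope.
Local Open Scope ring_scope.

(* Only meaningful for [0 < s]; for other [s] the integrand is not integrable
   and the value is junk. *)
Definition Gamma (R : realType) (s : R) : R :=
  \int[lebesgue_measure]_(t in `]0, +oo[) (t `^ (s - 1) * expR (- t)).

Definition rademacher (R : realType) (d : measure_display)
    (T : measurableType d) (P : probability T R) (r : R)
    (X : {RV P >-> R}) : Prop :=
  distribution P X [set 1] = r%:E /\ distribution P X [set -1] = (1 - r)%:E.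

Definition uniform_upto (R : realType) (d : measure_display)
    (T : measurableType d) (P : probability T R) (n : nat)
    (X : {RV P >-> nat}) : Prop :=
  forall k : nat, (1 <= k <= n)%N -> distribution P X [set k] = (n%:R^-1)%:E.

(* Independence of subfamilies is the case where some of the sets are [setT]. *)
Definition mutually_independent3 (R : realType)
    (d d1 d2 d3 : measure_display) (T : measurableType d)
    (T1 : measurableType d1) (T2 : measurableType d2) (T3 : measurableType d3)
    (P : probability T R) (X : T -> T1) (Y : T -> T2) (Z : T -> T3) : Prop :=
  forall (A : set T1) (B : set T2) (D : set T3),
    measurable A -> measurable B -> measurable D ->
    P (X @^-1` A `&` Y @^-1` B `&` Z @^-1` D) =
    (P (X @^-1` A) * P (Y @^-1` B) * P (Z @^-1` D))%E.

(* All sequences are indexed from 1: [eta 0], [alpha 0] and [beta 0] are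
   unconstrained and never used. *)
Record elephant_random_walk (R : realType) (d : measure_display)
    (T : measurableType d) (P : probability T R) (p q : R)
    (alpha : nat -> {RV P >-> R}) (beta : nat -> {RV P >-> nat})
    (eta : nat -> {RV P >-> R}) : Prop := ElephantRandomWalk {
  erw_first : rademacher q (eta 1%N) ;
  erw_alpha : forall n : nat, (1 <= n)%N -> rademacher p (alpha n) ;
  erw_beta : forall n : nat, (1 <= n)%N -> uniform_upto n (beta n) ;
  erw_indep : forall n : nat, (1 <= n)%N ->
    mutually_independent3 P (alpha n) (beta n)
      (fun w => [tuple eta i.+1 w | i < n]) ;
  erw_step : forall n : nat, (1 <= n)%N ->
    forall w : T, eta n.+1 w = alpha n w * eta (beta n w) w }.

Definition erw_position (R : realType) (d : measure_display)
    (T : measurableType d) (P : probability T R)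
    (eta : nat -> {RV P >-> R}) (n : nat) : {RV P >-> R} :=
  \sum_(1 <= i < n.+1) (eta i : {mfun T >-> R}).

Definition erw_a (R : realType) (p : R) (n : nat) : R :=
  if n == 1%N then 1
  else Gamma n%:R * Gamma (2 * p) / Gamma (n%:R + 2 * p - 1).

Definition erw_v (R : realType) (p : R) (n : nat) : R :=
  \sum_(1 <= i < n.+1) erw_a p i ^+ 2.

Definition erw_normalized (R : realType) (d : measure_display)
    (T : measurableType d) (P : probability T R) (p : R)
    (eta : nat -> {RV P >-> R}) (n : nat) : {RV P >-> R} :=
  (erw_a p n / Num.sqrt (erw_v p n)) \o* (erw_position eta n : {mfun T >-> R}).

Definition std_normal_cdf (R : realType) (x : R) : \bar R :=
  normal_prob 0 1 `]-oo, x].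

Definition wasserstein1_normal (R : realType) (d : measure_display)
    (T : measurableType d) (P : probability T R)
    (X : {RV P >-> R}) : \bar R :=
  (\int[lebesgue_measure]_x `|cdf X x - std_normal_cdf x|)%E.

(* Main.v *)
(* The position S_n is a Markov chain: given S_n = s, the next step is +-1 with
   probability (1 +- (2p-1)s/n)/2, so M_n = a_n S_n is a martingale after the
   first step, with increments bounded by 2 a_n and conditional variance
   a_n^2 (1 - ((2p-1) S_{n-1}/(n-1))^2).  Replacing its increments one at a time
   by independent Gaussian ones of variance a_i^2 (Lindeberg's method), with
   distribution functions compared directly in L^1(dx), yields
     C (A / sqrt v_n) (1 + ln (1 + v_n / A^2)
                       + sum_i (a_{i+1}/A)^2 v_i / (a_i i)^2)
   as a bound on the distance, where A dominates a_1, ..., a_n.  The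
   singularity at the last steps is removed by an extra Gaussian smoothing of
   variance A^2, and E M_i^2 <= v_i controls the defect of the conditional
   variances.  The rates follow with A = a_n if p < 1/2 and A = 1 if p > 1/2. *)

Require Import Defs.
From HB Require Import structures.
From mathcomp Require Import all_boot all_order all_algebra.
From mathcomp Require Import all_classical all_reals all_analysis.
From mathcomp Require Import measurable_realfun.
From mathcomp Require Import ring lra.

Import Order.TTheory GRing.Theory Num.Theory.
Import numFieldNormedType.Exports.

Local Open Scope classical_set_scope.
Local Open Scope ring_scope.

(** Gaussian majorants carry the comparison. Every replacement error is bounded pointwise in x by a
    multiple of [gauss8 ((x - m) / sd)], where the centre m may depend on the random position; the
    integral of this kernel is a multiple of sd and does not see m, so only the mean of the
    prefactor remains. The extra factor sd makes a step cheap: if r is the ratio of the step size to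
    sd, the third-order error r^3 becomes sd r^3, at most A / sqrt v_n times r^2, and r^2 is
    controlled by the decrease of the logarithm of the remaining variance, so the sum telescopes.
    Taylor matching fails for the first step, whose mean is 2q - 1; it is dropped at the cost of a
    Lipschitz bound, which is why q leaves no trace. No conditional expectation is formed: the law
    of the position is a finite sum over sign sequences, computed by a recursion on functions of the
    position. The Gamma function enters only through its positivity, its value at 1 and its
    functional equation. *)

Lemma is_derive_continuous {R : realType} (f : R -> R) (x df : R) :
  is_derive x 1 f df -> {for x, continuous f}.
Proof.
by move=> h; apply/differentiable_continuous/derivable1_diffP; exact: ex_derive.
Qed.

(** * Gamma function: finiteness, positivity, functional equation *)

Section Gamma_function.
Context {R : realType}.
Implicit Types (s t : R).
Notation mu := (@lebesgue_measure R).

Let gammaf s t : R := t `^ (s - 1) * expR (- t).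

Let is_derive_expRN t : is_derive t 1 (fun u : R => expR (- u)) (- expR (- t)).
Proof.
have := @is_derive1_comp _ expR (fun u : R => - u) t (expR (- t)) (-1) _ _.
by rewrite mulrN1; apply.
Qed.

Let is_derive_powR_expRN s t : 0 < t ->
  is_derive t 1 (fun u : R => u `^ s * expR (- u))
    (s * gammaf s t - gammaf (s + 1) t).
Proof.
move=> t0; have h1 := is_derive1_powR s t0.
have h2 := is_derive_expRN t.
apply: is_derive_eq.
by rewrite /gammaf /GRing.scale/= addrK; ring.
Qed.

Let continuous_gammaf s t : 0 < t -> {for t, continuous (gammaf s)}.
Proof.
move=> t0; have h := is_derive_powR_expRN (s - 1) t t0.
exact: is_derive_continuous h.
Qed.

Let gammaf_ge0 s t : 0 <= gammaf s t.
Proof. by rewrite mulr_ge0 ?powR_ge0 ?expR_ge0. Qed.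

Let measurable_gammaf s : measurable_fun (`]0, +oo[ : set R) (gammaf s).
Proof.
apply: open_continuous_measurable_fun => //.
by move=> t; rewrite inE/= in_itv/= andbT => t0; exact: continuous_gammaf.
Qed.

(** Beyond 1, the power is at most [t ^ k] for some integer [k], and the term of degree [k + 1] in
    the exponential series bounds the product by [(k + 1)! / t]. *)
Let cvg_powR_expRN s : t `^ s * expR (- t) @[t --> +oo] --> (0 : R).
Proof.
have [k sk] : exists k : nat, s <= k%:R.
  by exists (Num.truncn s).+1; rewrite ltW// truncnS_gt.
have bnd t : 1 <= t -> t `^ s * expR (- t) <= k.+1`!%:R / t.
  move=> t1; have t0 : 0 < t by lra.
  rewrite expRN ler_pdivrMr ?expR_gt0//.
  rewrite (le_trans (ler_powR _ sk))// powR_mulrn ?(ltW t0)//.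
  have /(_ (ltW t0)) := @expR_ge1Dxn _ t k.
  have f0 : 0 < k.+1`!%:R :> R by rewrite ltr0n fact_gt0.
  move=> h; have {h} : t ^+ k.+1 / k.+1`!%:R <= expR t by lra.
  rewrite ler_pdivrMr// exprS => h.
  by rewrite mulrAC ler_pdivlMr// mulrC [leRHS]mulrC.
apply/cvgrPdist_le => /= e e0; near=> t.
have t1 : 1 <= t by near: t; exact: nbhs_pinfty_ge.
rewrite sub0r normrN ger0_norm ?mulr_ge0 ?powR_ge0 ?expR_ge0//.
rewrite (le_trans (bnd _ t1))// ler_pdivrMr; last by lra.
rewrite mulrC -ler_pdivrMr//; near: t; exact: nbhs_pinfty_ge.
Unshelve. all: by end_near. Qed.

(** Kept in the extended reals, where nonnegative integrals add and scale before they are known to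
    be finite. *)
Let eGamma s : \bar R := (\int[mu]_(t in `]0%R, +oo[) (gammaf s t)%:E)%E.

Let gammafS s t : 0 < t -> gammaf (s + 1) t = t * gammaf s t.
Proof.
move=> t0; rewrite /gammaf addrK mulrA; congr (_ * _).
rewrite -{2}(powRr1 (ltW t0)) -powRD; first by rewrite addrCA subrr addr0.
by rewrite (gt_eqF t0) implybT.
Qed.

Let powR_expRN_at_right0 s : 0 < s ->
  t `^ s * expR (- t) @[t --> 0^'+] --> (0 : R).
Proof.
move=> s0; rewrite -[X in _ --> X](mul0r (expR (- 0))).
apply: cvgM; first exact: powR_cvg0.
apply: cvg_at_right_filter.
have h : is_derive (0 : R) 1 (fun u : R => expR (- u)) (- expR (- 0)).
  exact: is_derive_expRN.
exact: is_derive_continuous h.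
Qed.

(** The integrand is the derivative of [F], nonnegative up to [s]; the integral is the monotone
    limit of those over compact intervals away from 0, where the fundamental theorem of calculus
    applies. *)
Let integral_near0 s : 0 < s ->
  (\int[mu]_(t in `]0%R, s]) (s * gammaf s t - gammaf (s + 1) t)%:E =
   (s `^ s * expR (- s))%:E)%E.
Proof.
move=> s0; set F := fun u : R => u `^ s * expR (- u).
(* [n.+2] keeps the left end strictly below [s], even for [n = 0]. *)
pose I n : set R := `[s / n.+2%:R, s]%classic.
have In n t : I n t -> 0 < t.
  rewrite /I/= in_itv/= => /andP[+ _]; apply: lt_le_trans.
  by rewrite divr_gt0.
have IU : \bigcup_n I n = `]0, s]%classic.
  apply/seteqP; split => t /=.
    move=> [n _] h; have := In _ _ h; move: h.
    by rewrite /I/= !in_itv/= => /andP[_ ->] ->.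
  rewrite in_itv/= => /andP[t0 ts].
  have [n sn] : exists n : nat, s / t <= n%:R.
    by exists (Num.truncn (s / t)).+1; rewrite ltW// truncnS_gt.
  exists n => //; rewrite /I/= in_itv/= ts andbT.
  rewrite ler_pdivrMr// -ler_pdivrMl// mulrC (le_trans sn)//.
  by rewrite ler_nat -addn2 leq_addr.
have cF t : 0 < t ->
    {for t, continuous (fun t => s * gammaf s t - gammaf (s + 1) t)}.
  move=> t0; apply: cvgB; last exact: continuous_gammaf.
  by apply: cvgM; [exact: cvg_cst|exact: continuous_gammaf].
rewrite -IU.
pose g t : \bar R := (s * gammaf s t - gammaf (s + 1) t)%:E.
have cv : (\int[mu]_(t in I n) g t)%E @[n --> \oo] -->
    (\int[mu]_(t in \bigcup_n I n) g t)%E.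
  apply: ge0_nondecreasing_set_cvg_integral.
  - apply/nondecreasing_seqP => n; rewrite subsetEset => t.
    rewrite /I/= !in_itv/= => /andP[h ->]; rewrite andbT (le_trans _ h)//.
    by rewrite ler_pM2l// lef_pV2 ?posrE// ler_nat.
  - by move=> n; exact: measurable_itv.
  - move=> n; apply/measurable_EFinP.
    apply: (@measurable_funS _ _ _ _ (`]0, +oo[%classic : set R)) => //.
      by move=> t /In; rewrite /= in_itv/= andbT.
    by apply: measurable_funB => //; exact: measurable_funM.
  - move=> n t h; have t0 := In _ _ h; rewrite lee_fin gammafS// -mulrBl.
    rewrite mulr_ge0// subr_ge0; move: h; rewrite /I/= in_itv/=.
    by case/andP.
apply: (cvg_unique (@ereal_hausdorff R) cv).
have -> : (fun n => \int[mu]_(t in I n) g t)%E =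
    (fun n => (F s - F (s / n.+2%:R))%:E).
  apply/funext => n; rewrite EFinB.
  have ltn : s / n.+2%:R < s by rewrite ltr_pdivrMr// ltr_pMr// ltr1n.
  apply: continuous_FTC2 => //.
  - apply: continuous_in_subspaceT => t; rewrite inE => /In; exact: cF.
  - split.
    + move=> t; rewrite in_itv/= => /andP[t1 _].
      have t0 : 0 < t by apply: lt_trans t1; rewrite divr_gt0.
      by have h := is_derive_powR_expRN s t t0; exact: ex_derive.
    + have t0 : 0 < s / n.+2%:R by rewrite divr_gt0.
      apply: cvg_at_right_filter.
      have := continuous_gammaf (s + 1) _ t0.
      by rewrite /gammaf addrK; exact.
    + apply: cvg_at_left_filter.
      have := continuous_gammaf (s + 1) _ s0.
      by rewrite /gammaf addrK; exact.
  - move=> t; rewrite in_itv/= => /andP[t1 _].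
    have t0 : 0 < t by apply: lt_trans t1; rewrite divr_gt0.
    have h := is_derive_powR_expRN s t t0.
    by rewrite derive1E derive_val.
apply: cvg_EFin; first exact: nearW.
rewrite /comp/= -[X in _ --> X]subr0; apply: cvgB; first exact: cvg_cst.
have h := powR_expRN_at_right0 _ s0.
have /cvg_at_rightP := h; apply; split.
  by move=> n; rewrite divr_gt0.
rewrite -[X in _ --> X](mulr0 s); apply: cvgM; first exact: cvg_cst.
have := @cvg_harmonic R; rewrite -cvg_shiftS; exact.
Qed.

Let integral_neary s : 0 < s ->
  (\int[mu]_(t in `[s, +oo[) (gammaf (s + 1) t - s * gammaf s t)%:E =
   (s `^ s * expR (- s))%:E)%E.
Proof.
move=> s0.
rewrite (@ge0_continuous_FTC2y _ _
   (fun u : R => - (u `^ s * expR (- u))) _ 0).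
- by rewrite EFinN oppeK add0e.
- move=> t st; rewrite gammafS; last exact: lt_le_trans st.
  by rewrite -mulrBl mulr_ge0// subr_ge0.
- apply: continuous_in_subspaceT => t; rewrite inE/= in_itv/= andbT => st.
  have t0 : 0 < t by exact: lt_le_trans st.
  apply: cvgB; first exact: continuous_gammaf.
  by apply: cvgM; [exact: cvg_cst|exact: continuous_gammaf].
- by rewrite -oppr0; apply: cvgN; exact: cvg_powR_expRN.
- move=> t st; have h := is_derive_powR_expRN s t (lt_trans s0 st).
  exact: ex_derive.
- apply: cvgN; apply: cvg_at_right_filter.
  by have := continuous_gammaf (s + 1) _ s0; rewrite /gammaf addrK; exact.
- move=> t; rewrite in_itv/= andbT => st.
  have h := is_derive_powR_expRN s t (lt_trans s0 st).
  by rewrite derive1E derive_val opprB.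
Qed.

(* Splitting the integrals at [t = s], where the derivative
   [(s - t) t^(s-1) exp(-t)] of [t^s exp(-t)] changes sign, gives the functional
   equation without any integrability argument. *)
Let eGammaS s : 0 < s -> eGamma (s + 1) = (s%:E * eGamma s)%E.
Proof.
move=> s0.
have m0s r : measurable_fun `]0, s] (gammaf r).
  apply: (measurable_funS _ _ (measurable_gammaf r)) => //.
  by move=> t /=; rewrite !in_itv/= andbT => /andP[].
have msy r : measurable_fun `[s, +oo[ (gammaf r).
  apply: (measurable_funS _ _ (measurable_gammaf r)) => //.
  by move=> t /=; rewrite !in_itv/= !andbT; exact: lt_le_trans.
have Em0s r : measurable_fun `]0, s] (EFin \o gammaf r) by exact/measurable_EFinP.
have Emsy r : measurable_fun `[s, +oo[ (EFin \o gammaf r) by exact/measurable_EFinP.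
have mnear0 : measurable_fun `]0, s]
    (EFin \o (fun t => s * gammaf s t - gammaf (s + 1) t)).
  by apply/measurable_EFinP/measurable_funB => //; exact: measurable_funM.
have mneary : measurable_fun `[s, +oo[
    (EFin \o (fun t => gammaf (s + 1) t - s * gammaf s t)).
  by apply/measurable_EFinP/measurable_funB => //; exact: measurable_funM.
have msg : measurable_fun `[s, +oo[ (EFin \o (fun t => s * gammaf s t)).
  by apply/measurable_EFinP; exact: measurable_funM.
have split r : eGamma r = (\int[mu]_(t in `]0%R, s]) (gammaf r t)%:E +
    \int[mu]_(t in `[s, +oo[) (gammaf r t)%:E)%E.
  have U : (`]0, s] `|` `]s, +oo[ = `]0, +oo[ :> set R)%classic.
    by rewrite -itv_bndbnd_setU// bnd_simp ?ltW.
  rewrite /eGamma -U ge0_integral_setU//.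
  - congr (_ + _)%E; apply: integral_itv_obnd_cbnd.
    apply: (measurable_funS _ _ (Emsy r)) => //.
    by move=> t /=; rewrite !in_itv/= !andbT => /ltW.
  - by rewrite U; apply/measurable_EFinP; exact: measurable_gammaf.
  - by move=> t _; rewrite lee_fin.
  - apply/disj_setPS => t [] /=; rewrite !in_itv/= andbT => /andP[_ ts] st.
    by rewrite ltNge ts in st.
have ->  : (s%:E * eGamma s = \int[mu]_(t in `]0%R, s]) (s * gammaf s t)%:E +
    \int[mu]_(t in `[s, +oo[) (s * gammaf s t)%:E)%E.
  rewrite split ge0_muleDr; last 2 first.
  - by apply: integral_ge0 => t _; rewrite lee_fin.
  - by apply: integral_ge0 => t _; rewrite lee_fin.
  rewrite -!ge0_integralZl_EFin ?(ltW s0)//.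
  - by move=> t _; rewrite lee_fin.
  - exact: Emsy.
  - by move=> t _; rewrite lee_fin.
  - exact: Em0s.
rewrite split.
have -> : (\int[mu]_(t in `]0%R, s]) (s * gammaf s t)%:E =
    \int[mu]_(t in `]0%R, s]) (gammaf (s + 1) t)%:E + (s `^ s * expR (- s))%:E)%E.
  rewrite -integral_near0// -ge0_integralD//=.
  - by apply: eq_integral => t _; rewrite -EFinD [in RHS]addrC subrK.
  - by move=> t _; rewrite lee_fin.
  - exact: Em0s.
  - move=> t; rewrite in_itv/= => /andP[t0 ts].
    by rewrite lee_fin gammafS// -mulrBl mulr_ge0// subr_ge0.
have -> : (\int[mu]_(t in `[s, +oo[) (gammaf (s + 1) t)%:E =
    \int[mu]_(t in `[s, +oo[) (s * gammaf s t)%:E + (s `^ s * expR (- s))%:E)%E.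
  rewrite -integral_neary// -ge0_integralD//=.
  - by apply: eq_integral => t _; rewrite -EFinD [in RHS]addrC subrK.
  - by move=> t _; rewrite lee_fin mulr_ge0 ?(ltW s0).
  - move=> t; rewrite in_itv/= andbT => st.
    rewrite lee_fin gammafS ?(lt_le_trans s0)// -mulrBl mulr_ge0// subr_ge0//.
by rewrite addeA addeAC.
Qed.

Let eGamma_ge0 s : (0 <= eGamma s)%E.
Proof. by apply: integral_ge0 => t _; rewrite lee_fin. Qed.

Let eGamma1 : eGamma 1 = 1%E.
Proof.
rewrite /eGamma; under eq_integral do rewrite /gammaf subrr powRr0 mul1r.
have mN : measurable_fun (`]0, +oo[ : set R) (fun t : R => (expR (- t))%:E).
  apply/measurable_EFinP; apply: measurableT_comp => //.
rewrite integral_itv_obnd_cbnd//.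
have := @integral_exponential_pdf R 1 ltr01.
rewrite -(setUv `[0, +oo[%classic) ge0_integral_setU//=; last 4 first.
- exact: measurableC.
- by rewrite setUv; apply/measurable_EFinP; exact: measurable_exponential_pdf.
- by move=> t _; rewrite lee_fin exponential_pdf_ge0.
- exact/disj_setPCl.
rewrite [X in (_ + X)%E]integral0_eq ?adde0; last first.
  by move=> x x0; rewrite /exponential_pdf patchE ifF// memNset.
move=> <-; apply: eq_integral => t; rewrite inE/= in_itv/= andbT => t0.
by rewrite exponential_pdfE//= mul1r mulN1r.
Qed.

Let eGamma2 : eGamma 2 = 1%E.
Proof. have -> : (2 : R) = 1 + 1 by lra.
by rewrite eGammaS// eGamma1 mule1. Qed.

(** The exponent [s - 1] lies between 0 and 1, so the power is at most [1 + t]. *)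
Let eGamma_lty_12 s : 1 <= s <= 2 -> (eGamma s < +oo)%E.
Proof.
move=> /andP[s1 s2]; apply: (@le_lt_trans _ _ (eGamma 1 + eGamma 2)%E).
  rewrite /eGamma -ge0_integralD//=.
  - apply: ge0_le_integral => //=.
    + by move=> t _; rewrite lee_fin.
    + by apply/measurable_EFinP; exact: measurable_gammaf.
    + by apply: emeasurable_funD; apply/measurable_EFinP; exact: measurable_gammaf.
    + move=> t; rewrite in_itv/= andbT => t0.
      rewrite -EFinD lee_fin /gammaf -mulrDl ler_wpM2r ?expR_ge0//.
      rewrite subrr powRr0 (_ : 2 - 1 = 1); last lra.
      rewrite powRr1 ?ltW//.
      have [t1|t1] := leP t 1.
        have : t `^ (s - 1) <= 1.
          rewrite -[leRHS](powRr0 t); apply: ger_powR; lra.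
        lra.
      have : t `^ (s - 1) <= t.
        rewrite -[leRHS](powRr1 (ltW t0)); apply: ler_powR; lra.
      lra.
  - by move=> t _; rewrite lee_fin.
  - by apply/measurable_EFinP; exact: measurable_gammaf.
  - by move=> t _; rewrite lee_fin.
  - by apply/measurable_EFinP; exact: measurable_gammaf.
by rewrite eGamma1 eGamma2 ltry.
Qed.

(** The functional equation spreads finiteness from [[1, 2]]: downwards because an infinite value at
    [t] would force one at [t + 1], upwards by induction on unit intervals. *)
Let eGamma_lty s : 0 < s -> (eGamma s < +oo)%E.
Proof.
move=> s0.
have H n : forall t : R, 0 < t <= n.+2%:R -> (eGamma t < +oo)%E.
  elim: n => [|n IH] t /andP[t0 tn].
    have [t1|t1] := leP 1 t; first by apply: eGamma_lty_12; rewrite t1.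
    rewrite ltey; apply/eqP => h.
    have := eGammaS t t0; rewrite h gt0_muley ?lte_fin// => e.
    by have := eGamma_lty_12 (t + 1); rewrite e ltxx => /(_ _)/implyP; lra.
  have [t1|t1] := leP t n.+2%:R; first by apply: IH; rewrite t0.
  have t2 : 0 < t - 1 by rewrite subr_gt0 (le_lt_trans _ t1)// ler1n.
  have := eGammaS _ t2; rewrite subrK => ->.
  rewrite lte_mul_pinfty ?lee_fin ?ltW//; apply: IH.
  by rewrite t2/= lerBlDr natr1.
apply: (H (Num.truncn s)); rewrite s0/= ltW//.
by rewrite (lt_trans (truncnS_gt s))// ltr_nat.
Qed.

(** On [[1, 2]] the power is at least [t^-1], hence at least 1/2, for every positive [s]. *)
Let eGamma_gt0 s : 0 < s -> (0 < eGamma s)%E.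
Proof.
move=> s0.
apply: (@lt_le_trans _ _ (2^-1 * expR (- 2))%:E).
  by rewrite lte_fin mulr_gt0 ?expR_gt0// invr_gt0.
apply: (@le_trans _ _ (\int[mu]_(t in `[1%R, 2%R]) (gammaf s t)%:E)%E).
  apply: (@le_trans _ _ (\int[mu]_(t in `[1%R, 2%R]) (2^-1 * expR (- 2))%:E)%E).
    rewrite integral_cst//= lebesgue_measure_itv/= lte_fin.
    rewrite (_ : 1 < 2 = true); last by apply/idP; lra.
    rewrite -EFinD -EFinM lee_fin (_ : 2 - 1 = 1); [lra|lra].
  apply: ge0_le_integral => //=.
  - apply/measurable_EFinP; apply: (measurable_funS _ _ (measurable_gammaf s)) => //.
    by move=> t /=; rewrite !in_itv/= andbT => /andP[+ _]; exact: lt_le_trans.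
  - move=> t; rewrite in_itv/= => /andP[t1 t2]; rewrite lee_fin /gammaf.
    apply: ler_pM; rewrite ?invr_ge0 ?expR_ge0//.
      apply: (@le_trans _ _ (t `^ (- 1))).
        by rewrite powR_inv1 ?lef_pV2 ?posrE//; lra.
      by apply: ler_powR => //; lra.
    by rewrite ler_expR lerN2.
apply: ge0_subset_integral => //=.
- by apply/measurable_EFinP; exact: measurable_gammaf.
- by move=> t _; rewrite lee_fin.
- by move=> t /=; rewrite !in_itv/= andbT => /andP[+ _]; exact: lt_le_trans.
Qed.

(** Finiteness matters as much as positivity: [Gamma] is the [fine] part of the integral, and [fine]
    sends [+oo] to 0. *)
Lemma Gamma_gt0 s : 0 < s -> 0 < Gamma s.
Proof.
move=> s0; rewrite /Gamma /Rintegral; apply: fine_gt0.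
by rewrite eGamma_gt0// eGamma_lty.
Qed.

Lemma GammaS s : 0 < s -> Gamma (s + 1) = s * Gamma s.
Proof.
move=> s0; rewrite /Gamma /Rintegral.
rewrite -[X in fine X]/(eGamma (s + 1)) -[X in s * fine X]/(eGamma s).
rewrite eGammaS// fineM// ge0_fin_numE//; exact: eGamma_lty.
Qed.

Lemma Gamma1 : Gamma (1 : R) = 1.
Proof. by rewrite /Gamma /Rintegral -[X in fine X]/(eGamma 1) eGamma1. Qed.

End Gamma_function.

(** * Taylor bounds from the mean value theorem *)

Section mean_value_bounds.
Context {R : realType}.
Implicit Types (f g : R -> R) (a b M t : R).

(** The segment is parametrized as [a + l * (b - a)] so that [a] and [b] may come in either
    order. *)
Lemma mean_value_le f f' a b M :
  (forall t, is_derive t 1 f (f' t)) ->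
  (forall l, 0 <= l <= 1 -> `|f' (a + l * (b - a))| <= M) ->
  `|f b - f a| <= M * `|b - a|.
Proof.
move=> df hM.
have cf (S : set R) : {within S, continuous f}.
  by apply: continuous_in_subspaceT => t _; exact: is_derive_continuous (df t).
wlog ab : a b hM / a <= b => [wl|].
  have [ab|/ltW ba] := leP a b; first exact: wl.
  rewrite distrC (distrC b); apply: wl => // l l01.
  have -> : b + l * (a - b) = a + (1 - l) * (b - a) by ring.
  by apply: hM; lra.
have [c] := MVT_segment ab (fun t _ => df t) (cf _).
rewrite in_itv/= => /andP[ac cb] ->; rewrite normrM ler_wpM2r//.
have [ab0|ab0] := eqVneq (b - a) 0.
  have := hM 0; rewrite ab0 mul0r addr0 (_ : c = a); last by lra.
  by apply; lra.
have := hM ((c - a) / (b - a)); rewrite divfK// addrCA subrr addr0; apply.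
have ba0 : 0 < b - a by rewrite lt_def ab0 subr_ge0.
by rewrite divr_ge0 ?ler_pdivrMr ?(ltW ba0)//; lra.
Qed.

(** Two nested mean value bounds, the outer one for [f] minus its linear part. The factor 1/2 of the
    sharp remainder is given up. *)
Lemma taylor2_le f f' f'' a b M :
  (forall t, is_derive t 1 f (f' t)) -> (forall t, is_derive t 1 f' (f'' t)) ->
  (forall l, 0 <= l <= 1 -> `|f'' (a + l * (b - a))| <= M) ->
  `|f b - f a - (b - a) * f' a| <= M * `|b - a| ^+ 2.
Proof.
move=> df df' hM.
pose g t := f t - t * f' a.
have dg t : is_derive t 1 g (f' t - f' a).
  by apply: is_derive_eq; rewrite scaler1 scaler0 add0r.
have -> : f b - f a - (b - a) * f' a = g b - g a by rewrite /g; ring.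
rewrite expr2 mulrA; apply: mean_value_le dg _ => l /andP[l0 l1].
have M0 : 0 <= M by apply: le_trans (hM 0 _) => //; lra.
apply: (@le_trans _ _ (M * `|a + l * (b - a) - a|)).
  apply: mean_value_le df' _ => k /andP[k0 k1].
  have -> : a + k * (a + l * (b - a) - a) = a + k * l * (b - a) by ring.
  by apply: hM; rewrite mulr_ge0//= mulr_ile1.
rewrite ler_wpM2l// addrC addKr normrM ger0_norm// ler_piMl//.
Qed.

Lemma taylor3_le f f' f'' f3 a b M :
  (forall t, is_derive t 1 f (f' t)) -> (forall t, is_derive t 1 f' (f'' t)) ->
  (forall t, is_derive t 1 f'' (f3 t)) ->
  (forall l, 0 <= l <= 1 -> `|f3 (a + l * (b - a))| <= M) ->
  `|f b - f a - (b - a) * f' a - 2^-1 * (b - a) ^+ 2 * f'' a|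
    <= M * `|b - a| ^+ 3.
Proof.
move=> df df' df'' hM.
pose g t := f t - t * f' a - 2^-1 * (t - a) ^+ 2 * f'' a.
have dg t : is_derive t 1 g (f' t - f' a - (t - a) * f'' a).
  apply: is_derive_eq; rewrite /GRing.scale/= /GRing.scale/=.
  by field.
have -> : f b - f a - (b - a) * f' a - 2^-1 * (b - a) ^+ 2 * f'' a = g b - g a.
  by rewrite /g; ring.
rewrite exprSr mulrA; apply: mean_value_le dg _ => l /andP[l0 l1].
have M0 : 0 <= M by apply: le_trans (hM 0 _) => //; lra.
apply: (@le_trans _ _ (M * `|a + l * (b - a) - a| ^+ 2)).
  apply: taylor2_le df' df'' _ => k /andP[k0 k1].
  have -> : a + k * (a + l * (b - a) - a) = a + k * l * (b - a) by ring.
  by apply: hM; rewrite mulr_ge0//= mulr_ile1.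
rewrite ler_wpM2l// addrC addKr normrM ger0_norm// lerXn2r ?nnegrE ?mulr_ge0//.
by rewrite ler_piMl.
Qed.

End mean_value_bounds.

(** * Normal distribution function with Gaussian error bounds *)

Section normal_cdf.
Context {R : realType}.
Implicit Types (u d r t th : R).
Notation mu := (@lebesgue_measure R).

Definition Phi u : R := fine (std_normal_cdf u).

Definition phi u : R := normal_pdf 0 1 u.

(** Up to a factor, the centred normal density of standard deviation 2. It decays more slowly than
    [phi], which leaves room for bounded shifts, rescalings and polynomial factors. *)
Definition gauss8 u : R := expR (- (u ^+ 2 / 8)).

Lemma phiE u : phi u = normal_peak 1 * expR (- (u ^+ 2 / 2)).
Proof.
rewrite /phi normal_pdfE ?oner_eq0//; congr (_ * expR _).
by rewrite subr0 expr1n mulNr.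
Qed.

Lemma is_derive_Phi u : is_derive u 1 Phi (phi u).
Proof.
have iphi := integrable_normal_pdf (0 : R) 1.
have [||||d e] := @continuous_FTC1 R phi -oo%O u (u + 1).
- by rewrite ltrDl.
- by apply: integrableS iphi.
- exact: ltNyr.

- by apply: continuous_normal_pdf; exact: oner_neq0.
by split; [exact: d|rewrite -derive1E; exact: e].
Qed.

Lemma is_derive_phi u : is_derive u 1 phi (- u * phi u).
Proof.
have -> : phi = fun u => normal_peak 1 * expR (- (u ^+ 2 / 2)).
  by apply/funext => v; exact: phiE.
have h : is_derive u 1 (fun u : R => - (u ^+ 2 / 2)) (- u).
  by apply: is_derive_eq; rewrite /GRing.scale/=; field.
have h2 := @is_derive1_comp _ expR _ u _ _ _ h.
apply: is_derive_eq; rewrite /GRing.scale/=; ring.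
Qed.

Lemma is_derive_phi1 u :
  is_derive u 1 (fun u => - u * phi u) ((u ^+ 2 - 1) * phi u).
Proof.
have h := is_derive_phi u.
apply: is_derive_eq; rewrite /GRing.scale/=; ring.
Qed.

Lemma normal_peak1_le1 : normal_peak 1 <= 1 :> R.
Proof.
have p1 : 1 <= pi *+ 2 :> R by have := @pi_ge2 R; rewrite mulr2n; lra.
rewrite /normal_peak expr1n mul1r invf_le1 ?sqrtr_gt0; last lra.
by rewrite -[leLHS](@sqrtr1 R) ler_sqrt; lra.
Qed.

Lemma phi_le u : 0 <= phi u <= expR (- (u ^+ 2 / 2)).
Proof.
rewrite phiE mulr_ge0 ?normal_peak_ge0 ?expR_ge0//=.
by rewrite ler_piMl ?expR_ge0 ?normal_peak1_le1.
Qed.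

Lemma gauss8_ge0 u : 0 <= gauss8 u.
Proof. exact: expR_ge0. Qed.

(* [exp(u^2/8)] absorbs polynomial factors. *)
Lemma pow_gauss_le u :
  `|u| * expR (- (u ^+ 2 / 4)) <= 9 * gauss8 u /\
  `|u| ^+ 3 * expR (- (u ^+ 2 / 4)) <= 256 * gauss8 u.
Proof.
have e : expR (- (u ^+ 2 / 4)) = expR (- (u ^+ 2 / 8)) * expR (- (u ^+ 2 / 8)).
  by rewrite -expRD; congr expR; field.
have k0 : 0 < expR (- (u ^+ 2 / 8)) by exact: expR_gt0.
have h2 : expR (u ^+ 2 / 16) ^+ 2 * expR (- (u ^+ 2 / 8)) = 1.
  by rewrite -expRM_natl -expRD -[RHS]expR0; congr expR; field.
have h1 : (1 + u ^+ 2 / 16) ^+ 2 <= expR (u ^+ 2 / 16) ^+ 2.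
  rewrite lerXn2r ?nnegrE ?expR_ge0 ?expR_ge1Dx//.
  by rewrite addr_ge0// divr_ge0// sqr_ge0.
have h3 : (1 + u ^+ 2 / 16) ^+ 2 * expR (- (u ^+ 2 / 8)) <= 1.
  by rewrite -[leRHS]h2 ler_wpM2r// ltW.
have a0 : 0 <= `|u| by [].
rewrite /gauss8 e -[u ^+ 2]real_normK ?num_real//.
rewrite -[u ^+ 2]real_normK ?num_real// in k0 h3.
move: (`|u|) a0 k0 h3 => v v0; set K := expR _ => K0 h3.
have B1 : v <= 9 * (1 + v ^+ 2 / 16) ^+ 2 by nra.
have B3 : v ^+ 3 <= 256 * (1 + v ^+ 2 / 16) ^+ 2.
  have : 0 <= v ^+ 2 * (v - 1) ^+ 2 by rewrite mulr_ge0 ?sqr_ge0.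
  have : 0 <= (v ^+ 2) ^+ 2 by exact: sqr_ge0.
  have := sqr_ge0 v; lra.
have {}B1 := ler_wpM2r (ltW K0) B1; have {}B3 := ler_wpM2r (ltW K0) B3.
by split; rewrite mulrA ler_wpM2r ?(ltW K0)//; lra.
Qed.

(** Completing the square: [(u + d)^2 / 4 = u^2 / 8 - d^2 / 4 + (u + 2 d)^2 / 8], where [d^2 / 4] is
    at most 1. *)
Lemma gauss_shift_le u d : `|d| <= 2 ->
  expR (- ((u + d) ^+ 2 / 4)) <= expR 1 * gauss8 u.
Proof.
move=> d2; rewrite -expRD ler_expR.
have : d ^+ 2 <= 4.
  by rewrite -real_normK ?num_real//; have := normr_ge0 d; nra.
have : 0 <= (u + 2 * d) ^+ 2 by exact: sqr_ge0.
nra.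
Qed.

(** A bound on the third derivative of [Phi], needed for the Taylor remainder; half of the exponent
    pays for the polynomial factor. *)
Lemma phi2_le u : `|(u ^+ 2 - 1) * phi u| <= 4 * expR (- (u ^+ 2 / 4)).
Proof.
have /andP[p0 p1] := phi_le u.
rewrite normrM (ger0_norm p0).
have e : expR (- (u ^+ 2 / 2)) = expR (- (u ^+ 2 / 4)) * expR (- (u ^+ 2 / 4)).
  by rewrite -expRD; congr expR; field.
have h2 : expR (u ^+ 2 / 4) * expR (- (u ^+ 2 / 4)) = 1 by rewrite expRxMexpNx_1.
have h1 := expR_ge1Dx (u ^+ 2 / 4).
have k0 : 0 < expR (- (u ^+ 2 / 4)) by exact: expR_gt0.
apply: (@le_trans _ _ ((u ^+ 2 + 1) * expR (- (u ^+ 2 / 2)))).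
  apply: ler_pM => //.
  rewrite (le_trans (ler_normB _ _))// normr1 ger0_norm ?sqr_ge0//.
rewrite e mulrA ler_wpM2r ?(ltW k0)//.
have : u ^+ 2 + 1 <= 4 * expR (u ^+ 2 / 4) by lra.
move=> /(ler_wpM2r (ltW k0)) /le_trans; apply.
by rewrite -mulrA h2 mulr1.
Qed.

Lemma Phi_lipschitz u d : `|d| <= 2 ->
  `|Phi (u + d) - Phi u| <= expR 1 * gauss8 u * `|d|.
Proof.
move=> d2.
have := @mean_value_le _ Phi phi u (u + d) (expR 1 * gauss8 u) is_derive_Phi.
rewrite [u + d - u]addrC addKr; apply => l /andP[l0 l1].
have /andP[p0 p1] := phi_le (u + l * d).
rewrite ger0_norm// (le_trans p1)//.
apply: (le_trans _ (gauss_shift_le u (l * d) _)).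
  by rewrite ler_expR lerN2 ler_wpM2l ?sqr_ge0//; lra.
rewrite normrM ger0_norm//; have := normr_ge0 d; nra.
Qed.

Lemma Phi_taylor3 u d : `|d| <= 2 ->
  `|Phi (u + d) - Phi u - d * phi u - 2^-1 * d ^+ 2 * (- u * phi u)|
    <= 4 * (expR 1 * gauss8 u) * `|d| ^+ 3.
Proof.
move=> d2.
have := @taylor3_le _ Phi phi _ _ u (u + d) (4 * (expR 1 * gauss8 u))
  is_derive_Phi is_derive_phi is_derive_phi1.
rewrite [u + d - u]addrC addKr; apply => l /andP[l0 l1].
rewrite (le_trans (phi2_le _))// ler_wpM2l// gauss_shift_le//.
rewrite normrM ger0_norm//; have := normr_ge0 d; nra.
Qed.

(** Dividing by [sqrt (1 + r)] means adding variance [r] to the Gaussian. By the heat equation the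
    first-order effect is [r / 2] times the second derivative [- u * phi u] of [Phi]. *)
Lemma Phi_scale2 u r : 0 <= r <= 1 ->
  `|Phi (u / Num.sqrt (1 + r)) - Phi u - 2^-1 * r * (- u * phi u)|
    <= 73 * gauss8 u * r ^+ 2.
Proof.
move=> /andP[r0 r1].
have ww : Num.sqrt (1 + r) ^+ 2 = 1 + r by rewrite sqr_sqrtr//; lra.
have w1 : 1 <= Num.sqrt (1 + r).
  by rewrite -[leLHS]sqrtr1 ler_sqrt; lra.
move: (Num.sqrt (1 + r)) ww w1 => w ww w1.
(* The relative displacement, [u / w - u = - (k * u)]; it differs from [r / 2] by at most
   [r ^+ 2]. *)
pose k := 1 - w^-1.
have w0 : 0 < w by lra.
have wv : w * w^-1 = 1 by rewrite mulfV// gt_eqF.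
have v0 : 0 < w^-1 by rewrite invr_gt0.
have v1 : w^-1 <= 1 by rewrite invf_le1.
have k0 : 0 <= k by rewrite /k; lra.
have rE : r = w ^+ 2 - 1 by lra.
have kr : k <= 2^-1 * r.
  have -> : k = w^-1 * (w - 1) by rewrite /k mulrBr mulrC wv mulr1.
  rewrite rE; nra.
have kr2 : 2^-1 * r - k <= r ^+ 2.
  have -> : 2^-1 * r - k = (w - 1) ^+ 2 * (2^-1 + w^-1).
    by rewrite /k rE; field; rewrite gt_eqF.
  have -> : r ^+ 2 = (w - 1) ^+ 2 * (w + 1) ^+ 2 by rewrite rE; ring.
  by rewrite ler_wpM2l ?sqr_ge0//; nra.
have E : u / w - u = - (k * u) by rewrite /k; ring.
have [P1 P3] := pow_gauss_le u.
have K0 := expR_ge0 (- (u ^+ 2 / 4)).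
have T := @taylor2_le _ Phi phi _ u (u / w) (`|u| * expR (- (u ^+ 2 / 4)))
  is_derive_Phi is_derive_phi.
have {T}T : `|Phi (u / w) - Phi u + k * u * phi u|
    <= 64 * gauss8 u * r ^+ 2.
  have -> : Phi (u / w) - Phi u + k * u * phi u =
     Phi (u / w) - Phi u - (u / w - u) * phi u by rewrite E; ring.
  apply: le_trans (T _) _.
    move=> l /andP[l0 l1].
    have -> : u + l * (u / w - u) = (1 - l * k) * u by rewrite E; ring.
    have lk : w^-1 <= 1 - l * k by rewrite /k; nra.
    have lk1 : 1 - l * k <= 1 by nra.
    have v2 : 2^-1 <= (1 - l * k) ^+ 2.
      have : 2^-1 <= w^-1 ^+ 2.
        by rewrite exprVn ww lef_pV2 ?posrE; lra.
      nra.
    rewrite mulNr normrN !normrM (ger0_norm (_ : 0 <= 1 - l * k)); last lra.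
    have /andP[p0 p1] := phi_le ((1 - l * k) * u).
    apply: ler_pM => //.
    - by rewrite mulr_ge0//; lra.
    - by rewrite ler_piMl.
    - rewrite ger0_norm// (le_trans p1)// ler_expR lerN2 exprMn.
      by have := sqr_ge0 u; nra.
  rewrite E normrN normrM exprMn ger0_norm//.
  (* As [k] is at most [r / 2], the constant 256 of the cubic factor drops to 64; the missing 9 of
     73 comes from replacing [k] by [r / 2]. *)
  have k2 : k ^+ 2 <= r ^+ 2 / 4 by nra.
  rewrite (_ : _ * _ * _ = k ^+ 2 * (`|u| ^+ 3 * expR (- (u ^+ 2 / 4))));
    last by ring.
  apply: (@le_trans _ _ (r ^+ 2 / 4 * (256 * gauss8 u))).
    by apply: ler_pM => //; rewrite ?sqr_ge0// mulr_ge0// exprn_ge0.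
  by rewrite le_eqVlt; apply/orP; left; apply/eqP; field.
have {}P1 : `|(2^-1 * r - k) * u * phi u| <= 9 * gauss8 u * r ^+ 2.
  have /andP[p0 p1] := phi_le u.
  rewrite !normrM (ger0_norm p0) ger0_norm; last lra.
  rewrite -mulrA [leRHS]mulrC; apply: ler_pM => //.
  - lra.
  - by rewrite mulr_ge0.
  apply: le_trans P1; apply: ler_pM => //; rewrite (le_trans p1)//.
  by rewrite ler_expR; have := sqr_ge0 u; lra.
have -> : Phi (u / w) - Phi u - 2^-1 * r * (- u * phi u) =
   (Phi (u / w) - Phi u + k * u * phi u) + (2^-1 * r - k) * u * phi u by ring.
by rewrite (le_trans (ler_normD _ _))//; lra.
Qed.

Lemma phi1_le u : `|- u * phi u| <= 9 * gauss8 u.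
Proof.
have /andP[p0 p1] := phi_le u.
have [P1 _] := pow_gauss_le u; apply: le_trans P1.
rewrite mulNr normrN normrM (ger0_norm p0) ler_wpM2l// (le_trans p1)//.
by rewrite ler_expR; have := sqr_ge0 u; lra.
Qed.

Lemma Phi_scale u r : 0 <= r <= 1 ->
  `|Phi (u / Num.sqrt (1 + r)) - Phi u| <= 78 * gauss8 u * r.
Proof.
move=> r01; have := Phi_scale2 u r r01; have := phi1_le u.
have := gauss8_ge0 u; case/andP: r01 => r0 r1.
set A := Phi _ - Phi _; set B := - u * phi u; set K := gauss8 u => K0 hB hA.
have -> : A = (A - 2^-1 * r * B) + 2^-1 * r * B by ring.
rewrite (le_trans (ler_normD _ _))// (normrM _ B) ger0_norm; last by lra.
have : 73 * K * r ^+ 2 <= 73 * K * r.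
  by rewrite ler_wpM2l//; [lra|nra].
have : 2^-1 * r * `|B| <= 2^-1 * r * (9 * K) by rewrite ler_wpM2l//; lra.
have : 0 <= K * r by rewrite mulr_ge0.
lra.
Qed.

(** [32 e] is the Taylor remainder [4 e |d|^3] of a jump with [|d|] at most [2 r]; 73 comes from
    [Phi_scale2]. *)
Definition step_const : R := 32 * expR 1 + 73.

(* The jump [+-1 - th] is centred with variance [1 - th^2], so the first two
   Taylor terms match those of the Gaussian increment of variance [r^2]. *)
Lemma Phi_step u r th : 0 <= r <= 1 -> `|th| <= 1 ->
  `|(1 + th) / 2 * Phi (u - r * (1 - th)) + (1 - th) / 2 * Phi (u + r * (1 + th))
     - Phi (u / Num.sqrt (1 + r ^+ 2))|
   <= step_const * (r ^+ 3 + r ^+ 2 * th ^+ 2) * gauss8 u.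
Proof.
move=> /andP[r0 r1]; rewrite ler_norml => /andP[th1 th2].
have K0 := gauss8_ge0 u; have E0 := expR_ge0 (1 : R).
have T1 : `|- (r * (1 - th))| <= 2 * r.
  by rewrite normrN ger0_norm; nra.
have T2 : `|r * (1 + th)| <= 2 * r by rewrite ger0_norm; nra.
have H1 := Phi_taylor3 u (- (r * (1 - th))) (le_trans T1 _).
have {}H1 := H1 ltac:(lra).
have H2 := Phi_taylor3 u (r * (1 + th)) (le_trans T2 _).
have {}H2 := H2 ltac:(lra).
have H3 := Phi_scale2 u (r ^+ 2) _.
have {}H3 := H3 ltac:(nra).
have H4 := phi1_le u.
have B1 : `|- (r * (1 - th))| ^+ 3 <= 8 * r ^+ 3.
  have -> : 8 * r ^+ 3 = (2 * r) ^+ 3 by ring.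
  by rewrite lerXn2r ?nnegrE//; lra.
have B2 : `|r * (1 + th)| ^+ 3 <= 8 * r ^+ 3.
  have -> : 8 * r ^+ 3 = (2 * r) ^+ 3 by ring.
  by rewrite lerXn2r ?nnegrE//; lra.
have B3 : (r ^+ 2) ^+ 2 <= r ^+ 3 by rewrite -exprM ler_wiXn2l.
move: H1 H2 H3 H4.
set P0 := Phi u; set P1 := Phi (u - _); set P2 := Phi (u + r * _).
set P3 := Phi (u / _); set Q := - u * phi u; set q := phi u.
set K := gauss8 u in K0 *.
set X1 := (X in `|X| <= _ -> _); set X2 := (X in _ -> `|X| <= _ -> _).
set X3 := (X in _ -> _ -> `|X| <= _ -> _) => H1 H2 H3 H4.
(* The first-order terms cancel; the second-order ones carry variance [r^2 (1 - th^2)] against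
   [r^2], which leaves the [Q] term. *)
have -> : (1 + th) / 2 * P1 + (1 - th) / 2 * P2 - P3 =
  (1 + th) / 2 * X1 + (1 - th) / 2 * X2 - X3 - (r ^+ 2 * th ^+ 2 / 2) * Q.
  by rewrite /X1 /X2 /X3; field.
have EK : 0 <= 4 * (expR 1 * K) by rewrite !mulr_ge0.
have {}H1 : `|X1| <= 4 * (expR 1 * K) * (8 * r ^+ 3).
  by rewrite (le_trans H1)// ler_wpM2l.
have {}H2 : `|X2| <= 4 * (expR 1 * K) * (8 * r ^+ 3).
  by rewrite (le_trans H2)// ler_wpM2l.
have {}H3 : `|X3| <= 73 * K * r ^+ 3.
  by rewrite (le_trans H3)// ler_wpM2l// mulr_ge0.
have N1 : `|(1 + th) / 2 * X1| = (1 + th) / 2 * `|X1|.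
  by rewrite normrM ger0_norm//; lra.
have N2 : `|(1 - th) / 2 * X2| = (1 - th) / 2 * `|X2|.
  by rewrite normrM ger0_norm//; lra.
have rt : 0 <= r ^+ 2 * th ^+ 2 by apply: mulr_ge0; exact: sqr_ge0.
have rt0 : 0 <= r ^+ 2 * th ^+ 2 / 2 by lra.
have N3 : `|r ^+ 2 * th ^+ 2 / 2 * Q| <= r ^+ 2 * th ^+ 2 / 2 * (9 * K).
  by rewrite normrM ger0_norm// ler_wpM2l.
have S : (1 + th) / 2 * `|X1| + (1 - th) / 2 * `|X2| <=
    4 * (expR 1 * K) * (8 * r ^+ 3).
  have a1 : (1 + th) / 2 * `|X1| <= (1 + th) / 2 * (4 * (expR 1 * K) * (8 * r ^+ 3)).
    by rewrite ler_wpM2l//; lra.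
  have a2 : (1 - th) / 2 * `|X2| <= (1 - th) / 2 * (4 * (expR 1 * K) * (8 * r ^+ 3)).
    by rewrite ler_wpM2l//; lra.
  lra.
apply: (@le_trans _ _ (`|(1 + th) / 2 * X1| + `|(1 - th) / 2 * X2| + `|X3|
    + `|r ^+ 2 * th ^+ 2 / 2 * Q|)).
  do 2! (rewrite (le_trans (ler_normB _ _))// lerD2r).
  exact: ler_normD.
have : 0 <= expR 1 * (r ^+ 2 * th ^+ 2 * K) by apply: mulr_ge0 => //; exact: mulr_ge0.
have : 0 <= r ^+ 2 * th ^+ 2 * K by exact: mulr_ge0.
rewrite N1 N2 /step_const; lra.
Qed.

Lemma normal_peak2E : normal_peak 1 = 2 * normal_peak 2 :> R.
Proof.
rewrite /normal_peak expr1n mul1r -mulrnAr.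
by rewrite sqrtrM ?sqr_ge0// sqrtr_sqr ger0_norm// invfM mulrA mulfV ?mul1r.
Qed.

(** The exponent is split: [phi t] is twice the density of standard deviation 2 times
    [exp (- 3 t^2 / 8)]. The last factor is at most [gauss8 u] on [A], and the density has mass at
    most 1 there. *)
Lemma normal_prob_tail (A : set R) u : measurable A ->
  (forall t, A t -> u ^+ 2 <= t ^+ 2) ->
  (normal_prob 0 1 A <= (2 * gauss8 u)%:E)%E.
Proof.
move=> mA hA.
apply: (@le_trans _ _ (\int[mu]_(t in A) ((2 * gauss8 u)%:E * (normal_pdf 0 2 t)%:E))%E).
  apply: ge0_le_integral => //.
  - by move=> t _; rewrite lee_fin normal_pdf_ge0.
  - by apply/measurable_EFinP/measurable_funTS; exact: measurable_normal_pdf.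
  - apply: measurable_funeM.
    by apply/measurable_EFinP/measurable_funTS; exact: measurable_normal_pdf.
  - move=> t /hA ut; rewrite -EFinM lee_fin -/(phi t) phiE normal_peak2E.
    rewrite normal_pdfE// /normal_fun subr0 -[leLHS]mulrA -[leRHS]mulrA.
    rewrite ler_wpM2l// [leRHS]mulrCA ler_wpM2l ?normal_peak_ge0//.
    rewrite -expRD ler_expR mulNr.
    have -> : (2 : R) ^+ 2 *+ 2 = 8 by rewrite -mulr_natr -natrX -natrM.
    by have := sqr_ge0 t; lra.
rewrite ge0_integralZl_EFin//; last 3 first.
- by move=> t _; rewrite lee_fin normal_pdf_ge0.
- by apply/measurable_EFinP/measurable_funTS; exact: measurable_normal_pdf.
- by rewrite mulr_ge0// gauss8_ge0.
rewrite -[leRHS]mule1 lee_wpmul2l ?lee_fin ?mulr_ge0 ?gauss8_ge0//.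
rewrite -(integral_normal_pdf (0 : R) 2); apply: ge0_subset_integral => //.
- by apply/measurable_EFinP; exact: measurable_normal_pdf.
- by move=> t _; rewrite lee_fin normal_pdf_ge0.
Qed.

Lemma std_normal_cdfE u : std_normal_cdf u = (Phi u)%:E.
Proof. by rewrite /Phi fineK// fin_num_measure. Qed.

(** The indicator is the distribution function of the point mass at 0, so this is the pointwise
    price of smoothing it into a standard normal law. *)
Lemma Phi_tail u : `|(0 <= u)%R%:R - Phi u| <= 2 * gauss8 u.
Proof.
have P0 : 0 <= Phi u by rewrite fine_ge0.
have P1 : Phi u <= 1.
  by rewrite -lee_fin -std_normal_cdfE probability_le1.
have [u0|u0] := leP 0 u.
  rewrite ger0_norm ?subr_ge0// -lee_fin EFinB -std_normal_cdfE /std_normal_cdf.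
  rewrite -probability_setC//; apply: normal_prob_tail; first exact: measurableC.
  move=> t /= /negP; rewrite in_itv/= -ltNge => ut; nra.
rewrite sub0r normrN ger0_norm// -lee_fin -std_normal_cdfE.
apply: normal_prob_tail => // t /=; rewrite in_itv/= => tu; nra.
Qed.

Lemma integral_gauss8 (m s c : R) : 0 < s -> 0 <= c ->
  (\int[mu]_x (c * gauss8 ((x - m) / s))%:E = (c * (s * Num.sqrt (8 * pi)))%:E)%E.
Proof.
move=> s0 c0.
have s2 : 2 * s != 0 by rewrite mulf_neq0// gt_eqF.
have pk : (normal_peak (2 * s))^-1 = s * Num.sqrt (8 * pi).
  rewrite /normal_peak invrK (_ : _ *+ 2 = s ^+ 2 * (8 * pi)).
    by rewrite sqrtrM ?sqr_ge0// sqrtr_sqr ger0_norm// ltW.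
  rewrite -mulr_natr; ring.
have pk0 : 0 < s * Num.sqrt (8 * pi).
  by rewrite mulr_gt0// sqrtr_gt0 mulr_gt0// pi_gt0.
transitivity (\int[mu]_x ((c * (s * Num.sqrt (8 * pi)))%:E *
    (normal_pdf m (2 * s) x)%:E))%E.
  apply: eq_integral => x _; rewrite -EFinM; congr EFin.
  rewrite normal_pdfE// -mulrA; congr (_ * _).
  rewrite mulrA -pk mulVf ?mul1r; last by rewrite gt_eqF// normal_peak_gt0.
  rewrite /gauss8 /normal_fun; congr expR.
  rewrite mulNr; congr (- _); rewrite -mulr_natr; field.
  by rewrite gt_eqF.
rewrite ge0_integralZl_EFin//.
- by rewrite integral_normal_pdf mule1.
- by move=> t _; rewrite lee_fin normal_pdf_ge0.
- by apply/measurable_EFinP; exact: measurable_normal_pdf.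
- by rewrite mulr_ge0// ltW.
Qed.

Lemma measurable_gauss8 (m s c : R) :
  measurable_fun setT (fun x : R => c * gauss8 ((x - m) / s)).
Proof.
apply: measurable_funM => //; apply: measurableT_comp.
  apply: measurableT_comp => //; apply: measurableT_comp => //.
  by apply: measurable_funM => //; exact: measurable_funX.
by apply: measurable_funM => //; exact: measurable_funB.
Qed.

End normal_cdf.

(** * Sign sequences and the transition recursion *)

Section elephant_law.
Context {R : realType}.
Implicit Types (p q th s : R) (e : seq bool) (b : bool).

Definition sg b : R := if b then 1 else -1.

Definition walk e : R := \sum_(b <- e) sg b.

Fixpoint sign_seqs (n : nat) : seq (seq bool) :=
  if n is n'.+1 then
    [seq rcons e true | e <- sign_seqs n'] ++
    [seq rcons e false | e <- sign_seqs n']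
  else [:: [::]].

Definition erw_drift p (n : nat) : R := (2 * p - 1) / n%:R.

(* [erw_mean p q n f] is the expectation of [f] at the position after [n.+1]
   steps: given [S_n = s], the next step is [+-1] with probability
   [(1 +- (2 p - 1) s / n) / 2]. *)
Fixpoint erw_mean p q (n : nat) (f : R -> R) : R :=
  if n is n'.+1 then
    erw_mean p q n' (fun s => (1 + erw_drift p n * s) / 2 * f (s + 1) +
                              (1 - erw_drift p n * s) / 2 * f (s - 1))
  else q * f 1 + (1 - q) * f (- 1).

Lemma walk_rcons e b : walk (rcons e b) = walk e + sg b.
Proof. by rewrite /walk -cats1 big_cat big_seq1. Qed.

Lemma size_sign_seqs n e : e \in sign_seqs n -> size e = n.
Proof.
elim: n e => [|n IH] e /=; first by rewrite inE => /eqP ->.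
by rewrite mem_cat => /orP[] /mapP[f /IH <- ->]; rewrite size_rcons.
Qed.

Lemma big_sign_seqsS (V : nmodType) n (F : seq bool -> V) :
  \sum_(e <- sign_seqs n.+1) F e =
  \sum_(e <- sign_seqs n) (F (rcons e true) + F (rcons e false)).
Proof. by rewrite /= big_cat !big_map big_split. Qed.

End elephant_law.

(** * Total probability up to null events *)

Section total_probability.
Context {R : realType} {d : measure_display} {T : measurableType d}
  (P : probability T R).
Local Open Scope ereal_scope.

(** Disjoint events of total probability 1 cover the space up to a null event; this is all that
    [uniform_upto] says about the values of [beta]. *)
Lemma probability_total n (B : 'I_n -> set T) (A : set T) :
  (forall i, measurable (B i)) -> trivIset setT B ->
  \sum_(i < n) P (B i) = 1 -> measurable A ->
  P A = \sum_(i < n) P (A `&` B i).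
Proof.
move=> mB tB B1 mA; set U := \big[setU/set0]_(i < n) B i.
have mU : measurable U by exact: bigsetU_measurable.
have PU : P U = 1 by rewrite measure_bigsetU_ord.
have PUC : P (A `\` U) = 0.
  apply: (@subset_measure0 _ _ _ P _ (~` U)) => //.
  - exact: measurableD.
  - exact: measurableC.
  - by rewrite [LHS](probability_setC P mU) PU subee.
rewrite -[in LHS](setUIDK A U) measureU//; last 3 first.
- exact: measurableI.
- exact: measurableD.
- by rewrite setDE setIACA setICr setI0.
rewrite [X in _ + X]PUC adde0 big_distrr/= measure_bigsetU_ord//.
- by move=> i; exact: measurableI.
- exact: trivIset_setIl.
Qed.

(** The two parts exhaust [E] up to a null event, as the two signs do for a step that is [+-1] only
    almost surely. *)
Lemma probability_split (E E1 E2 A : set T) :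
  measurable E -> measurable E1 -> measurable E2 -> measurable A ->
  E1 `<=` E -> E2 `<=` E -> E1 `&` E2 = set0 -> P E = P E1 + P E2 ->
  P (A `&` E) = P (A `&` E1) + P (A `&` E2).
Proof.
move=> mE mE1 mE2 mA sE1 sE2 E12 PE.
have mE12 : measurable (E1 `|` E2) by exact: measurableU.
have P3 : P (E `\` (E1 `|` E2)) = 0.
  rewrite measureD// ?ltey_eq ?fin_num_measure//.
  by rewrite setIidr ?subUset// measureU// -PE subee// fin_num_measure.
have P4 : P (A `&` E `\` (E1 `|` E2)) = 0.
  apply: (@subset_measure0 _ _ _ P _ (E `\` (E1 `|` E2))) => //.
  - by apply: measurableD => //; exact: measurableI.
  - exact: measurableD.
  - by move=> w [[_ Ew] nw].
rewrite -[in LHS](setUIDK (A `&` E) (E1 `|` E2)) measureU//; last 3 first.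
- by apply: measurableI => //; exact: measurableI.
- by apply: measurableD => //; exact: measurableI.
- by rewrite setDE setIACA setICr setI0.
rewrite [X in _ + X = _]P4 adde0 -setIA (_ : E `&` _ = E1 `|` E2).
  rewrite setIUr measureU//.
  - exact: measurableI.
  - exact: measurableI.
  - by rewrite setIACA E12 setI0.
by apply/setIidPr; rewrite subUset.
Qed.

End total_probability.

(** * From the probability space to the Markov recursion *)

Section elephant_probability.
Context {R : realType} {d : measure_display} {T : measurableType d}
  (P : probability T R) (p q : R)
  (alpha : nat -> {RV P >-> R}) (beta : nat -> {RV P >-> nat})
  (eta : nat -> {RV P >-> R}).
Hypothesis erw : elephant_random_walk p q alpha beta eta.
Implicit Types (e : seq bool) (b : bool).

Definition steps_event e : set T :=
  [set w | forall i, (i < size e)%N -> eta i.+1 w = sg (nth false e i)].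

Lemma steps_event_rcons e b :
  steps_event (rcons e b) =
  steps_event e `&` [set w | eta (size e).+1 w = sg b].
Proof.
apply/seteqP; split => w /=.
  move=> h; split => [i ie|].
    by have := h i; rewrite size_rcons nth_rcons ie; apply; rewrite ltnW.
  by have := h (size e); rewrite size_rcons nth_rcons ltnn eqxx; apply.
move=> [h hb] i; rewrite size_rcons nth_rcons ltnS leq_eqVlt => /predU1P[->|ie].
  by rewrite ltnn eqxx.
by rewrite ie; exact: h.
Qed.

Lemma measurable_eta_eq n (x : R) : measurable [set w | eta n w = x].
Proof.
exact: (measurable_funPTI (eta n) (measurable_set1 x)).
Qed.

Lemma measurable_steps_event e : measurable (steps_event e).
Proof.
elim/last_ind: e => [|e b IH].
  rewrite (_ : steps_event [::] = setT); first exact: measurableT.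
  by apply/seteqP; split.
by rewrite steps_event_rcons; apply: measurableI => //; exact: measurable_eta_eq.
Qed.

Lemma prob_beta n k : (k < n)%N ->
  P (beta n @^-1` [set k.+1]) = (n%:R^-1)%:E.
Proof. by case: n => // n kn; apply: (erw_beta erw). Qed.

Lemma prob_alpha n b : (1 <= n)%N ->
  P (alpha n @^-1` [set sg b]) = ((1 + (2 * p - 1) * sg b) / 2)%:E.
Proof.
move=> n1; have [h1 h2] := erw_alpha erw n1.
by case: b; [rewrite [LHS]h1|rewrite [LHS]h2]; congr EFin; rewrite /sg; field.
Qed.

(** Once the recalled time [k.+1] is fixed, the new step is [alpha] times a known sign. This
    determines [alpha] and makes the event a product event for the independent triple. *)
Lemma prob_steps_beta e b k : (k < size e)%N ->
  P (steps_event (rcons e b) `&` beta (size e) @^-1` [set k.+1]) =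
  (((1 + (2 * p - 1) * sg b * sg (nth false e k)) / 2)%:E *
    ((size e)%:R^-1)%:E * P (steps_event e))%E.
Proof.
move=> ke; set n := size e; have n1 : (1 <= n)%N by exact: leq_ltn_trans ke.
pose D : set (n.-tuple R) :=
  [set t | forall i : 'I_n, tnth t i = sg (nth false e i)].
have mD : measurable D.
  rewrite (_ : D = \bigcap_(i in [set: 'I_n])
      ((fun t : n.-tuple R => tnth t i) @^-1` [set sg (nth false e i)])).
    apply: fin_bigcap_measurable => // i _; rewrite -[X in measurable X]setTI.
    exact: measurable_tnth.
  apply/seteqP; split => t /=; first by move=> h i _; exact: h.
  by move=> h i; exact: (h i I).
have ZD : (fun w => [tuple eta i.+1 w | i < n]) @^-1` D = steps_event e.
  apply/seteqP; split => w /=.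
    by move=> h i ie; have := h (Ordinal ie); rewrite tnth_mktuple.
  by move=> h i; rewrite tnth_mktuple; exact: h.
(* [sg (b == nth false e k)] is the product of the two signs, the only value of [alpha] that leads
   from one to the other. *)
have -> : steps_event (rcons e b) `&` beta n @^-1` [set k.+1] =
    alpha n @^-1` [set sg (b == nth false e k)] `&` beta n @^-1` [set k.+1] `&`
    (fun w => [tuple eta i.+1 w | i < n]) @^-1` D.
  rewrite ZD steps_event_rcons; apply/seteqP; split => w /=.
    move=> [[h hb] bk]; do 2! split => //.
    move: hb; rewrite (erw_step erw n1) bk h//.
    by case: b (nth false e k) => -[]; rewrite /sg/=; lra.
  move=> [[ha bk] h]; split => //; split => //.
  rewrite (erw_step erw n1) bk h// ha.
  by case: b {ha} (nth false e k) => -[]; rewrite /sg/=; lra.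
rewrite (erw_indep erw n1)// ZD prob_alpha// prob_beta//; congr (_%:E * _ * _)%E.
by case: b (nth false e k) => -[]; rewrite /sg/=; lra.
Qed.

(** Averaging over the uniform recalled time turns the past signs into their sum; this is where the
    position becomes a Markov chain. *)
Lemma prob_steps_rcons e b : (0 < size e)%N ->
  P (steps_event (rcons e b)) =
  (((1 + erw_drift p (size e) * walk e * sg b) / 2)%:E * P (steps_event e))%E.
Proof.
move=> e0; set n := size e.
have n0 : n%:R != 0 :> R by rewrite pnatr_eq0 -lt0n.
rewrite (@probability_total _ _ _ P n
  (fun k => beta n @^-1` [set (nat_of_ord k).+1])); last 4 first.
- by move=> k; exact: (measurable_funPTI (beta n)).
- by move=> i j _ _ [w [/= -> [/val_inj]]].
- rewrite (eq_bigr (fun _ => (n%:R^-1)%:E)) => [|k _]; last exact: prob_beta.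
  by rewrite sumEFin sumr_const card_ord -[_ *+ n]mulr_natl mulfV.
- exact: measurable_steps_event.
rewrite (eq_bigr (fun k : 'I_n =>
  (((1 + (2 * p - 1) * sg b * sg (nth false e k)) / 2) * n%:R^-1)%:E *
   P (steps_event e))%E) => [|k _]; last by rewrite prob_steps_beta.
rewrite -(fineK (fin_num_measure P _ (measurable_steps_event e))).
set x := fine _.
rewrite (eq_bigr (fun k : 'I_n =>
  ((1 + (2 * p - 1) * sg b * sg (nth false e k)) / 2 * n%:R^-1 * x)%:E))//.
rewrite sumEFin -EFinM; congr EFin; rewrite -!mulr_suml; congr (_ * _).
rewrite big_split/= sumr_const card_ord -mulr_sumr.
have -> : \sum_(k < n) sg (nth false e k) = walk e :> R.
  by rewrite /walk (big_nth false) big_mkord.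
by rewrite /erw_drift -/n -mulr_natl; field.
Qed.

(** The probabilities of the two continuations add up to that of [steps_event e]. The empty sequence
    is treated apart, its continuation being governed by the law of the first step. *)
Lemma prob_steps_split e (A : set T) : measurable A ->
  P (A `&` steps_event e) = (P (A `&` steps_event (rcons e true)) +
                            P (A `&` steps_event (rcons e false)))%E.
Proof.
move=> mA; apply: probability_split => //;
  rewrite ?steps_event_rcons//; try by [exact: measurable_steps_event |
   apply: measurableI; [exact: measurable_steps_event|exact: measurable_eta_eq]].
- by apply/seteqP; split => w //= [[_ ->] [_]]; rewrite /sg; lra.
rewrite -!steps_event_rcons; have [e0|e0] := posnP (size e).
  move/size0nil: e0 => ->.
  have [h1 h2] := erw_first erw.
  have E0 : steps_event [::] = setT by apply/seteqP; split.
  rewrite !steps_event_rcons E0 !setTI probability_setT.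
  have -> : P [set w | eta (size [::]).+1 w = sg true] = q%:E by rewrite -h1.
  have -> : P [set w | eta (size [::]).+1 w = sg false] = (1 - q)%:E by rewrite -h2.
  by rewrite -EFinD addrC subrK.
rewrite !prob_steps_rcons//.
rewrite -(fineK (fin_num_measure P _ (measurable_steps_event e))).
by rewrite -!EFinM -EFinD /sg; congr EFin; field.
Qed.

Lemma prob_sign_seqs n (A : set T) : measurable A ->
  P A = (\sum_(e <- sign_seqs n) P (A `&` steps_event e))%E.
Proof.
move=> mA; elim: n => [|n IH].
  rewrite /= big_seq1 (_ : steps_event [::] = setT) ?setIT//.
  by apply/seteqP; split.
by rewrite big_sign_seqsS IH; apply: eq_bigr => e _; exact: prob_steps_split.
Qed.

(** The transition probability depends on [e] only through [walk e], so summing out the last sign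
    produces exactly the function inside the recursion of [erw_mean]. *)
Lemma sum_steps_erw_mean n (f : R -> R) :
  \sum_(e <- sign_seqs n.+1) fine (P (steps_event e)) * f (walk e) =
  erw_mean p q n f.
Proof.
elim: n f => [|n IH] f.
  rewrite big_sign_seqsS [sign_seqs 0]/= big_seq1 !steps_event_rcons !walk_rcons.
  rewrite {1 2}/walk big_nil !add0r.
  have [h1 h2] := erw_first erw.
  have E0 : steps_event [::] = setT by apply/seteqP; split.
  rewrite E0 !setTI.
  have -> : P [set w | eta (size [::]).+1 w = sg true] = q%:E by rewrite -h1.
  by have -> : P [set w | eta (size [::]).+1 w = sg false] = (1 - q)%:E
    by rewrite -h2.
rewrite big_sign_seqsS [erw_mean _ _ n.+1 _]/= -IH !big_seq.
apply: eq_bigr => e /size_sign_seqs se.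
rewrite !prob_steps_rcons ?se// !fineM ?fin_num_measure//;
  try exact: measurable_steps_event.
by rewrite /= !walk_rcons /sg mulr1 mulrN1; ring.
Qed.

Lemma erw_position_walk n e (w : T) : size e = n -> steps_event e w ->
  erw_position eta n w = walk e.
Proof.
elim/last_ind: e n => [|e b IH] n.
  by move=> <- _; rewrite /erw_position /walk big_geq// big_nil.
rewrite size_rcons => <-; rewrite steps_event_rcons => -[he hb].
rewrite walk_rcons /erw_position big_nat_recr//= -(IH _ erefl he) -hb.
by [].
Qed.

Lemma prob_erw_position n (B : set R) : measurable B ->
  P (erw_position eta n.+1 @^-1` B) = (erw_mean p q n (fun s => \1_B s))%:E.
Proof.
move=> mB.
have mX : measurable (erw_position eta n.+1 @^-1` B).
  exact: (measurable_funPTI (erw_position eta n.+1)).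
rewrite (@prob_sign_seqs n.+1)// -sum_steps_erw_mean -sumEFin !big_seq.
apply: eq_bigr => e /size_sign_seqs se; rewrite indicE.
have [eB|eB] := boolP (walk e \in B).
  rewrite mulr1 fineK ?fin_num_measure//; last exact: measurable_steps_event.
  congr (P _); apply/setIidPr => w /(erw_position_walk _ _ _ se) /= ->.
  by rewrite inE in eB.
rewrite mulr0 (_ : _ `&` _ = set0) ?measure0//.
apply/seteqP; split => w //= [+ /(erw_position_walk _ _ _ se) h].
by rewrite h; rewrite notin_setE in eB.
Qed.

Lemma cdf_erw_normalized n (x : R) :
  cdf (erw_normalized p eta n.+1) x =
  (erw_mean p q n
     (fun s => (erw_a p n.+1 / Num.sqrt (erw_v p n.+1) * s <= x)%R%:R))%:E.
Proof.
set c := _ / _.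
have mB : measurable [set s : R | c * s <= x].
  rewrite -[X in measurable X]setTI.
  have -> : [set s : R | c * s <= x] = (fun s => c * s) @^-1` `]-oo, x].
    by apply/seteqP; split => s /=; rewrite in_itv.
  have mc : measurable_fun setT ( *%R c) by exact: measurable_funM.
  exact: mc.
have -> : (fun s => (c * s <= x)%R%:R) = \1_[set s : R | c * s <= x] :> (R -> R).
  by apply/funext => s; rewrite indicE; congr (nat_of_bool _)%:R; apply/idP/idP;
    rewrite inE.
rewrite -prob_erw_position// /cdf /distribution /pushforward; congr (P _).
by apply/seteqP; split => w /=; rewrite in_itv/= mulrC.
Qed.

End elephant_probability.

(** Turns a squared step ratio into an increment of a logarithm. It follows from [ln y <= y - 1] at
    [y = 1 / (1 + x)] and [1 / (1 + x) <= 1 - x / 2] on [[0, 1]]. *)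
Lemma le_2ln1Dx {R : realType} (x : R) : 0 <= x -> x <= 1 -> x <= 2 * ln (1 + x).
Proof.
move=> x0 x1; have y0 : 0 < (1 + x)^-1 by rewrite invr_gt0; lra.
have y1 : (1 + x)^-1 <= 1 - x / 2.
  by rewrite -[leLHS]mul1r ler_pdivrMr; [nra|lra].
have := @le_ln1Dx R ((1 + x)^-1 - 1).
have -> : 1 + ((1 + x)^-1 - 1) = (1 + x)^-1 by ring.
by rewrite lnV ?posrE; [lra|lra].
Qed.

(** * Positivity of the mean functional and closeness in L^1 *)

Section elephant_mean.
Context {R : realType}.
Variables (p q : R).
Hypotheses (p01 : 0 <= p <= 1) (q01 : 0 <= q <= 1).
Implicit Types (n : nat) (s c x : R) (f g : R -> R).
Notation mu := (@lebesgue_measure R).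

Lemma erw_drift_le n s : `|s| <= n.+1%:R -> `|erw_drift p n.+1 * s| <= 1.
Proof.
move=> sn; rewrite /erw_drift mulrAC normrM normfV normr_nat.
rewrite ler_pdivrMr// mul1r normrM -[leRHS]mul1r ler_pM// ler_norml.
by case/andP: p01 => *; apply/andP; split; lra.
Qed.

(** [erw_mean] is linear, but its weights may be negative for [s] outside the range of the walk.
    Hence the restriction [|s| <= n.+1] in every comparison of means. *)
Lemma erw_weights_ge0 n s : `|s| <= n.+1%:R ->
  0 <= (1 + erw_drift p n.+1 * s) / 2 /\ 0 <= (1 - erw_drift p n.+1 * s) / 2.
Proof. by move/erw_drift_le; rewrite ler_norml => /andP[*]; split; lra. Qed.

Let next_bound n s : `|s| <= n.+1%:R ->
  `|s + 1| <= n.+2%:R /\ `|s - 1| <= n.+2%:R.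
Proof.
move=> sn; split; rewrite -[n.+2%:R]natr1.
  by rewrite (le_trans (ler_normD _ _))// normr1 lerD2r.
by rewrite (le_trans (ler_normB _ _))// normr1 lerD2r.
Qed.

Lemma erw_mean_le n f g : (forall s, `|s| <= n.+1%:R -> f s <= g s) ->
  erw_mean p q n f <= erw_mean p q n g.
Proof.
elim: n f g => [|n IH] f g fg /=.
  by rewrite lerD// ler_wpM2l ?fg ?normrN ?normr1//; case/andP: q01 => *; lra.
apply: IH => s sn; have [w1 w2] := erw_weights_ge0 _ _ sn.
by have [s1 s2] := next_bound _ _ sn; rewrite lerD// ler_wpM2l// fg.
Qed.

Lemma eq_erw_mean n f g : f =1 g -> erw_mean p q n f = erw_mean p q n g.
Proof. by move=> /funext ->. Qed.

Lemma erw_meanD n f g : erw_mean p q n (fun s => f s + g s) =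
  erw_mean p q n f + erw_mean p q n g.
Proof.
elim: n f g => [|n IH] f g /=; first by ring.
by rewrite -IH; apply: eq_erw_mean => s; ring.
Qed.

Lemma erw_meanZ n c f : erw_mean p q n (fun s => c * f s) =
  c * erw_mean p q n f.
Proof.
elim: n f => [|n IH] f /=; first by ring.
by rewrite -IH; apply: eq_erw_mean => s; ring.
Qed.

Lemma erw_mean_cst n c : erw_mean p q n (fun=> c) = c.
Proof.
elim: n => [|n IH] /=; first by ring.
by rewrite -[RHS]IH; apply: eq_erw_mean => s; field.
Qed.

Lemma erw_mean_ge0 n f : (forall s, `|s| <= n.+1%:R -> 0 <= f s) ->
  0 <= erw_mean p q n f.
Proof. by move=> f0; rewrite -(erw_mean_cst n 0); exact: erw_mean_le. Qed.

Lemma erw_mean_dist n f g h :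
  (forall s, `|s| <= n.+1%:R -> `|f s - g s| <= h s) ->
  `|erw_mean p q n f - erw_mean p q n g| <= erw_mean p q n h.
Proof.
move=> fgh.
have -> : erw_mean p q n f - erw_mean p q n g =
    erw_mean p q n (fun s => f s - g s).
  have -> : (fun s => f s - g s) = (fun s => f s + (- 1) * g s).
    by apply/funext => s; ring.
  by rewrite erw_meanD erw_meanZ; ring.
rewrite ler_norml; apply/andP; split.
  rewrite -mulN1r -erw_meanZ; apply: erw_mean_le => s /fgh.
  by rewrite ler_norml mulN1r => /andP[].
by apply: erw_mean_le => s /fgh; rewrite ler_norml => /andP[].
Qed.

Lemma measurable_erw_mean n (g : R -> R -> R) :
  (forall s, measurable_fun setT (g s)) ->
  measurable_fun setT (fun x => erw_mean p q n (g ^~ x)).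
Proof.
elim: n g => [|n IH] g mg /=.
  by apply: measurable_funD; exact: measurable_funM.
apply: (IH (fun s x => (1 + erw_drift p n.+1 * s) / 2 * g (s + 1) x +
  (1 - erw_drift p n.+1 * s) / 2 * g (s - 1) x)) => s.
by apply: measurable_funD; exact: measurable_funM.
Qed.

Let integral_comb (f g : R -> R) (c1 c2 F G : R) :
  measurable_fun setT f -> measurable_fun setT g ->
  (forall x, 0 <= f x) -> (forall x, 0 <= g x) -> 0 <= c1 -> 0 <= c2 ->
  (\int[mu]_x (f x)%:E <= F%:E)%E -> (\int[mu]_x (g x)%:E <= G%:E)%E ->
  (\int[mu]_x (c1 * f x + c2 * g x)%:E <= (c1 * F + c2 * G)%:E)%E.
Proof.
move=> mf mg f0 g0 c10 c20 fF gG.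
have mEf : measurable_fun setT (EFin \o f) by exact/measurable_EFinP.
have mEg : measurable_fun setT (EFin \o g) by exact/measurable_EFinP.
under eq_integral do rewrite EFinD.
rewrite ge0_integralD//=.
- under eq_integral do rewrite EFinM.
  under [X in (_ + X <= _)%E]eq_integral do rewrite EFinM.
  rewrite !ge0_integralZl_EFin//; try by move=> x _; rewrite lee_fin.
  by rewrite EFinD !EFinM leeD// lee_wpmul2l// lee_fin.
- by move=> x _; rewrite lee_fin mulr_ge0.
- by apply/measurable_EFinP; exact: measurable_funM.
- by move=> x _; rewrite lee_fin mulr_ge0.
- by apply/measurable_EFinP; exact: measurable_funM.
Qed.

(** A mean is a finite combination with nonnegative weights, so integration in [x] passes through
    it. *)
Lemma integral_erw_mean n (g : R -> R -> R) (G : R -> R) :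
  (forall s, measurable_fun setT (g s)) ->
  (forall s x, `|s| <= n.+1%:R -> 0 <= g s x) ->
  (forall s, `|s| <= n.+1%:R -> (\int[mu]_x (g s x)%:E <= (G s)%:E)%E) ->
  (\int[mu]_x (erw_mean p q n (g ^~ x))%:E <= (erw_mean p q n G)%:E)%E.
Proof.
elim: n g G => [|n IH] g G mg g0 gG /=.
  by apply: integral_comb => //; do ?[move=> x; apply: g0|apply: gG];
    rewrite ?normrN ?normr1//; case/andP: q01 => *; lra.
apply: (IH (fun s x => (1 + erw_drift p n.+1 * s) / 2 * g (s + 1) x +
  (1 - erw_drift p n.+1 * s) / 2 * g (s - 1) x)).
- by move=> s; apply: measurable_funD; exact: measurable_funM.
- move=> s x sn; have [w1 w2] := erw_weights_ge0 _ _ sn.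
  by have [s1 s2] := next_bound _ _ sn; rewrite addr_ge0// mulr_ge0// g0.
- move=> s sn; have [w1 w2] := erw_weights_ge0 _ _ sn.
  have [s1 s2] := next_bound _ _ sn.
  by apply: integral_comb => //; do ?[move=> x; apply: g0|apply: gG].
Qed.

(** A measurable majorant stands in for [|f - g|]; the measurability of [f] and [g] comes up only
    when a chain of such estimates becomes a Wasserstein distance. *)
Definition l1_close f g c := exists h : R -> R,
  [/\ measurable_fun setT h, forall x, `|f x - g x| <= h x &
      (\int[mu]_x (h x)%:E <= c%:E)%E].

Lemma l1_close_trans f g h c1 c2 :
  l1_close f g c1 -> l1_close g h c2 -> l1_close f h (c1 + c2).
Proof.
move=> [k1 [m1 fg1 i1]] [k2 [m2 fg2 i2]].
have k10 x : 0 <= k1 x by rewrite (le_trans _ (fg1 x)).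
have k20 x : 0 <= k2 x by rewrite (le_trans _ (fg2 x)).
exists (fun x => k1 x + k2 x); split.
- exact: measurable_funD.
- move=> x; have -> : f x - h x = (f x - g x) + (g x - h x) by ring.
  by rewrite (le_trans (ler_normD _ _))// lerD.
- have := integral_comb k1 k2 1 1 c1 c2 m1 m2 k10 k20 ler01 ler01 i1 i2.
  by rewrite !mul1r; under eq_integral do rewrite !mul1r.
Qed.

Lemma l1_close_le f g c1 c2 : l1_close f g c1 -> c1 <= c2 -> l1_close f g c2.
Proof.
move=> [k [m fg i]] c12; exists k; split => //.
by rewrite (le_trans i)// lee_fin.
Qed.

Lemma l1_close_mean n (f g : R -> R -> R) (c m : R -> R) (sd : R) : 0 < sd ->
  (forall s, `|s| <= n.+1%:R -> 0 <= c s) ->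
  (forall s x, `|s| <= n.+1%:R ->
     `|f s x - g s x| <= c s * gauss8 ((x - m s) / sd)) ->
  l1_close (fun x => erw_mean p q n (f ^~ x)) (fun x => erw_mean p q n (g ^~ x))
    (sd * Num.sqrt (8 * pi) * erw_mean p q n c).
Proof.
move=> sd0 c0 fg.
exists (fun x => erw_mean p q n (fun s => c s * gauss8 ((x - m s) / sd))); split.
- apply: (measurable_erw_mean _ (fun s x => c s * gauss8 ((x - m s) / sd))) => s.
  exact: measurable_gauss8.
- by move=> x; apply: erw_mean_dist => s sn; exact: fg.
- rewrite -erw_meanZ.
  apply: (integral_erw_mean _ (fun s x => c s * gauss8 ((x - m s) / sd))).
  + by move=> s; exact: measurable_gauss8.
  + by move=> s x sn; rewrite mulr_ge0 ?c0 ?gauss8_ge0.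
  + by move=> s sn; rewrite integral_gauss8 ?c0// mulrC.
Qed.

(** The deterministic case: [l1_close_mean] with data that ignore the position. *)
Lemma l1_close_gauss f g c sd : 0 < sd -> 0 <= c ->
  (forall x, `|f x - g x| <= c * gauss8 (x / sd)) ->
  l1_close f g (sd * Num.sqrt (8 * pi) * c).
Proof.
move=> sd0 c0 fg.
have := l1_close_mean 0 (fun=> f) (fun=> g) (fun=> c) (fun=> 0) sd sd0.
rewrite erw_mean_cst.
have E (h : R -> R) : (fun x => erw_mean p q 0 ((fun=> h) ^~ x)) = h.
  by apply/funext => x; rewrite /= -mulrDl addrCA subrr addr0 mul1r.
by rewrite !E; apply => // s x _; rewrite subr0.
Qed.

End elephant_mean.

(** * Lindeberg replacement for the rescaled walk *)

Section martingale_bound.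
Context {R : realType}.
Variables (p q : R).
Hypotheses (p01 : 0 <= p <= 1) (q01 : 0 <= q <= 1).
Variables (a v : nat -> R).
Hypothesis a_gt0 : forall n, (0 < n)%N -> 0 < a n.
Hypothesis a1 : a 1%N = 1.
Hypothesis aS : forall n, (0 < n)%N -> a n.+1 * (1 + erw_drift p n) = a n.
Hypothesis v1 : v 1%N = 1.
Hypothesis vS : forall n, (0 < n)%N -> v n.+1 = v n + a n.+1 ^+ 2.
Implicit Types (n i : nat) (s x : R).
Notation erw_mean := (erw_mean p q).

(** With drift [t], one step takes the second moment [m] to [(1 + 2 t) m + 1], and
    [1 + 2 t <= (1 + t)^2], the ratio of consecutive squared coefficients. The added 1 is matched by
    the new term of [v]. *)
Lemma erw_second_moment n :
  a n.+1 ^+ 2 * erw_mean n (fun s => s ^+ 2) <= v n.+1.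
Proof.
elim: n => [|n IH].
  by rewrite a1 v1 /= sqrrN expr1n; case/andP: q01 => *; lra.
rewrite vS//; apply: le_trans (_ : a n.+1 ^+ 2 * erw_mean n (fun s => s ^+ 2) +
   a n.+2 ^+ 2 <= _); last by rewrite lerD2r.
have -> : erw_mean n.+1 (fun s => s ^+ 2) =
    (1 + 2 * erw_drift p n.+1) * erw_mean n (fun s => s ^+ 2) + 1.
  rewrite /= -erw_meanZ -[X in _ + X](erw_mean_cst p q n) -erw_meanD.
  by apply: eq_erw_mean => s; field.
have m0 : 0 <= erw_mean n (fun s => s ^+ 2).
  by apply: erw_mean_ge0 => // s _; exact: sqr_ge0.
rewrite -(aS n.+1)// exprMn mulrDr mulr1 lerD2r.
rewrite -[leRHS]mulrA ler_wpM2l ?sqr_ge0// ler_wpM2r//.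
by have := sqr_ge0 (erw_drift p n.+1); lra.
Qed.

Variables (N : nat) (A : R).
Hypothesis A_gt0 : 0 < A.
Hypothesis aA : forall i, (0 < i <= N.+1)%N -> a i <= A.
Hypothesis Av : A ^+ 2 <= v N.+1.

Let rv := Num.sqrt (v N.+1).
Let vN_gt0 : 0 < v N.+1.
Proof. by apply: lt_le_trans Av; rewrite exprn_gt0. Qed.
Let rv_gt0 : 0 < rv. Proof. by rewrite sqrtr_gt0. Qed.
Let rvE : rv ^+ 2 = v N.+1. Proof. by rewrite sqr_sqrtr// ltW. Qed.

Let b i := a i / rv.
(** In units of [v N.+1], the Gaussian variance that replaces the steps after time [i], the
    smoothing [A ^+ 2] included. *)
Let var i := (v N.+1 - v i + A ^+ 2) / v N.+1.
Let sd i := Num.sqrt (var i).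
Let eps := A / rv.

Let v_le i j : (0 < i)%N -> (i <= j)%N -> v i <= v j.
Proof.
move=> i0; elim: j => [|j IH]; first by rewrite leqn0 => /eqP ->.
rewrite leq_eqVlt => /predU1P[<-//|]; rewrite ltnS => ij.
by rewrite (le_trans (IH ij))// vS ?(leq_trans i0)// lerDl sqr_ge0.
Qed.

Let eps_gt0 : 0 < eps. Proof. exact: divr_gt0. Qed.

Let eps2 : eps ^+ 2 = A ^+ 2 / v N.+1.
Proof. by rewrite /eps exprMn exprVn rvE. Qed.

Let eps_le1 : eps <= 1.
Proof.
rewrite /eps ler_pdivrMr// mul1r -[leLHS](ger0_norm (ltW A_gt0)) -sqrtr_sqr.
by rewrite ler_sqrt// ltW.
Qed.

Let var_ge i : (0 < i <= N.+1)%N -> eps ^+ 2 <= var i.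
Proof.
move=> /andP[i0 iN]; rewrite eps2 /var ler_pM2r ?invr_gt0//.
by rewrite lerDr subr_ge0 v_le.
Qed.

Let var_gt0 i : (0 < i <= N.+1)%N -> 0 < var i.
Proof. by move=> /var_ge; apply: lt_le_trans; rewrite exprn_gt0. Qed.

Let sd_gt0 i : (0 < i <= N.+1)%N -> 0 < sd i.
Proof. by move=> h; rewrite sqrtr_gt0 var_gt0. Qed.

Let eps_sd i : (0 < i <= N.+1)%N -> eps <= sd i.
Proof.
move=> h; rewrite -[leLHS](ger0_norm (ltW eps_gt0)) -sqrtr_sqr ler_sqrt ?var_ge//.
exact/ltW/var_gt0.
Qed.

Let sdE i : (0 < i <= N.+1)%N -> sd i ^+ 2 = var i.
Proof. by move=> h; rewrite sqr_sqrtr// ltW// var_gt0. Qed.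

Let b_gt0 i : (0 < i)%N -> 0 < b i.
Proof. by move=> i0; rewrite divr_gt0// a_gt0. Qed.

Let b_eps i : (0 < i <= N.+1)%N -> b i <= eps.
Proof. by move=> h; rewrite ler_pM2r ?invr_gt0// aA. Qed.

Let varS i : (0 < i)%N -> var i = var i.+1 + b i.+1 ^+ 2.
Proof.
by move=> i0; rewrite /var /b exprMn exprVn rvE [v i.+1]vS// -mulrDl; congr (_ / _); ring.
Qed.

(** Distribution function of the hybrid: [i.+1] steps of the walk, then an independent Gaussian of
    variance [var i.+1]. *)
Let D i x := erw_mean i (fun s => Phi ((x - b i.+1 * s) / sd i.+1)).

Let kappa : R := Num.sqrt (8 * pi).
Let kappa_ge0 : 0 <= kappa. Proof. exact: sqrtr_ge0. Qed.

(** After the last step only the smoothing is left, [sd N.+1 = eps], and [Phi_tail] removes it. *)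
Let last_step : l1_close
  (fun x => erw_mean N (fun s => (b N.+1 * s <= x)%R%:R)) (D N)
  (kappa * eps * 2).
Proof.
have h : (0 < N.+1 <= N.+1)%N by rewrite leqnn.
have sdN : sd N.+1 = eps.
  by rewrite /sd /var subrr add0r -eps2 sqrtr_sqr ger0_norm// ltW.
have := l1_close_mean p q p01 q01 N (fun s x => (b N.+1 * s <= x)%R%:R)
  (fun s x => Phi ((x - b N.+1 * s) / sd N.+1)) (fun=> 2)
  (fun s => b N.+1 * s) (sd N.+1) (sd_gt0 _ h).
rewrite erw_mean_cst [X in X * Num.sqrt _ * _]sdN (mulrC eps).
apply => // s x _; rewrite sdN.
have -> : (b N.+1 * s <= x) = (0 <= (x - b N.+1 * s) / eps).
  by rewrite ler_pdivlMr// mul0r subr_ge0.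
exact: Phi_tail.
Qed.

Let sd1E : sd 1 = Num.sqrt (1 + (A ^+ 2 - 1) / v N.+1).
Proof. by rewrite /sd /var v1; congr Num.sqrt; field; rewrite gt_eqF. Qed.

Let A_ge1 : 1 <= A. Proof. by rewrite -a1 aA. Qed.

Let r1_bounds : 0 <= (A ^+ 2 - 1) / v N.+1 <= eps ^+ 2.
Proof.
have A2 : 1 <= A ^+ 2 by rewrite expr_ge1// ltW.
rewrite divr_ge0 ?(ltW vN_gt0) ?subr_ge0//= eps2 ler_pM2r ?invr_gt0//; lra.
Qed.

Let sd1_ge1 : 1 <= sd 1.
Proof.
rewrite sd1E -[leLHS]sqrtr1 ler_sqrt; case/andP: r1_bounds; lra.
Qed.

(** No Taylor term cancels for a step of mean [2 q - 1], but its size [b 1] is at most [eps], so the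
    Lipschitz bound is affordable. *)
Let first_step : l1_close (D 0) (fun x => Phi (x / sd 1)) (kappa * eps * expR 1).
Proof.
have sd0 : 0 < sd 1 by exact: lt_le_trans sd1_ge1.
have b0 := b_gt0 1 isT.
have beps := b_eps 1 isT.
have bsd : b 1 / sd 1 <= 1.
  by rewrite ler_pdivrMr// mul1r (le_trans beps)// (le_trans eps_le1).
have := l1_close_mean p q p01 q01 0 (fun s x => Phi ((x - b 1 * s) / sd 1))
  (fun s x => Phi (x / sd 1)) (fun s => expR 1 * (b 1 / sd 1))
  (fun=> 0) (sd 1) sd0.
rewrite erw_mean_cst.
have -> : (fun x => erw_mean 0 ((fun=> fun x => Phi (x / sd 1)) ^~ x)) =
    (fun x => Phi (x / sd 1)).
  by apply/funext => x; rewrite erw_mean_cst.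
move=> h; apply: l1_close_le (h _ _) _.
- by move=> s _; rewrite mulr_ge0 ?expR_ge0// divr_ge0// ltW.
- move=> s x s1; rewrite subr0.
  have -> : (x - b 1 * s) / sd 1 = x / sd 1 + - (b 1 * s / sd 1) by ring.
  have le1 : `|- (b 1 * s / sd 1)| <= b 1 / sd 1.
    have bs0 : 0 <= b 1 / sd 1 by rewrite divr_ge0// ltW.
    by rewrite normrN mulrAC normrM (ger0_norm bs0) ler_piMr.
  apply: le_trans (Phi_lipschitz _ _ _) _; first by lra.
  by rewrite mulrAC ler_wpM2r ?gauss8_ge0// ler_wpM2l// expR_ge0.
- have -> : sd 1 * Num.sqrt (8 * pi) * (expR 1 * (b 1 / sd 1)) =
      kappa * b 1 * expR 1.
    by rewrite -/kappa; field; rewrite gt_eqF.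
  by rewrite ler_wpM2r ?expR_ge0// ler_wpM2l.
Qed.

(** Without the first step the Gaussian has variance [1 + (A^2 - 1) / v N.+1], since [v 1 = 1]; the
    excess over 1 is at most [eps ^+ 2]. *)
Let zeroth_step : l1_close (fun x => Phi (x / sd 1)) Phi (kappa * eps * 78).
Proof.
have /andP[r0 r1] := r1_bounds.
have e2 : eps ^+ 2 <= eps by rewrite expr2 ler_piMl// ltW.
have := l1_close_gauss p q p01 q01 (fun x => Phi (x / sd 1)) Phi
  (78 * ((A ^+ 2 - 1) / v N.+1)) 1 ltr01.
rewrite mul1r => h; apply: l1_close_le (h _ _) _.
- by rewrite mulr_ge0.
- move=> x; rewrite divr1 sd1E.
  have := Phi_scale x ((A ^+ 2 - 1) / v N.+1); rewrite r0 => /(_ _) H.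
  by rewrite mulrAC; apply: H; rewrite (le_trans r1)// (le_trans e2).
- by rewrite -/kappa mulrCA mulrC ler_wpM2r// ler_wpM2l// (le_trans r1).
Qed.

Let drift2 i : erw_drift p i.+1 ^+ 2 <= (i.+1%:R ^+ 2)^-1.
Proof.
rewrite /erw_drift exprMn exprVn -[leRHS]mul1r ler_pM2r.
  case/andP: p01 => *; nra.
by rewrite invr_gt0 exprn_gt0// ltr0n.
Qed.

(** Contribution of the variance defect: [v i.+1 / a i.+1 ^+ 2] bounds the second moment of the
    position and [1 / i.+1 ^+ 2] the squared drift. *)
Let rest i := a i.+2 ^+ 2 / A ^+ 2 * (v i.+1 / (a i.+1 ^+ 2 * i.+1%:R ^+ 2)).

Let mid_step i : (i < N)%N -> l1_close (D i.+1) (D i)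
  (kappa * eps * step_const * (2 * (ln (var i.+1) - ln (var i.+2)) + rest i)).
Proof.
move=> iN.
have h1 : (0 < i.+1 <= N.+1)%N by exact: ltnW.
have h2 : (0 < i.+2 <= N.+1)%N by rewrite ltnS.
pose r := b i.+2 / sd i.+2; pose th := erw_drift p i.+1.
have sd0 := sd_gt0 _ h2; have b0 := b_gt0 i.+2 isT.
have r0 : 0 <= r by rewrite divr_ge0// ltW.
(* The smoothing acts here: every remaining deviation is at least [eps], which dominates every
   coefficient. *)
have r1 : r <= 1.
  by rewrite ler_pdivrMr// mul1r (le_trans (b_eps _ h2))// eps_sd.
have step0 : 0 <= step_const :> R by rewrite addr_ge0// mulr_ge0// expR_ge0.
have rvar : 1 + r ^+ 2 = var i.+1 / var i.+2.
  rewrite varS// mulrDl mulfV ?gt_eqF ?var_gt0//.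
  by rewrite /r exprMn exprVn sdE.
have := l1_close_mean p q p01 q01 i
  (fun s x => (1 + th * s) / 2 * Phi ((x - b i.+2 * (s + 1)) / sd i.+2) +
              (1 - th * s) / 2 * Phi ((x - b i.+2 * (s - 1)) / sd i.+2))
  (fun s x => Phi ((x - b i.+1 * s) / sd i.+1))
  (fun s => step_const * r ^+ 3 + step_const * r ^+ 2 * th ^+ 2 * s ^+ 2)
  (fun s => b i.+1 * s) (sd i.+2) sd0.
rewrite erw_meanD erw_mean_cst erw_meanZ -/kappa => h.
apply: l1_close_le (h _ _) _.
- move=> s _; rewrite addr_ge0//.
    by rewrite mulr_ge0// exprn_ge0.
  by apply: mulr_ge0 (sqr_ge0 s); apply: mulr_ge0 (sqr_ge0 th);
    apply: mulr_ge0 (sqr_ge0 r).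
- move=> s x /(erw_drift_le p p01) ths.
  (* The martingale relation: [b i.+1 * s] is the conditional mean of the next rescaled position, so
     the two jumps are those of [Phi_step]. *)
  have bE : b i.+1 = b i.+2 * (1 + th) by rewrite /b -(aS i.+1)// mulrAC.
  have := Phi_step ((x - b i.+1 * s) / sd i.+2) r (th * s) _ ths.
  rewrite r0 r1 => /(_ isT).
  have -> : (x - b i.+1 * s) / sd i.+2 - r * (1 - th * s) =
      (x - b i.+2 * (s + 1)) / sd i.+2 by rewrite bE /r; ring.
  have -> : (x - b i.+1 * s) / sd i.+2 + r * (1 + th * s) =
      (x - b i.+2 * (s - 1)) / sd i.+2 by rewrite bE /r; ring.
  have -> : (x - b i.+1 * s) / sd i.+2 / Num.sqrt (1 + r ^+ 2) =
      (x - b i.+1 * s) / sd i.+1.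
    rewrite -mulrA -invfM; congr (_ / _); rewrite rvar /sd -sqrtrM.
      by congr Num.sqrt; rewrite mulrC divfK// gt_eqF// var_gt0.
    exact/ltW/var_gt0.
  move=> H; apply: (le_trans H); apply: ler_wpM2r; first exact: gauss8_ge0.
  by rewrite le_eqVlt; apply/orP; left; apply/eqP; ring.
- set m := erw_mean i _.
  have m0 : 0 <= m by apply: erw_mean_ge0 => // s _; exact: sqr_ge0.
  (* [1 + r ^+ 2] is the quotient of consecutive variances, so these bounds telescope. *)
  have lnr : r ^+ 2 <= 2 * (ln (var i.+1) - ln (var i.+2)).
    rewrite -ln_div ?posrE ?var_gt0// -rvar.
    have r20 : 0 <= r ^+ 2 by exact: sqr_ge0.
    have r21 : r ^+ 2 <= 1 by rewrite expr_le1.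
    exact: le_2ln1Dx.
  have t1 : sd i.+2 * r ^+ 3 <= eps * (2 * (ln (var i.+1) - ln (var i.+2))).
    have -> : sd i.+2 * r ^+ 3 = b i.+2 * r ^+ 2.
      by rewrite /r; field; rewrite gt_eqF.
    by apply: ler_pM => //; [exact: ltW|exact: sqr_ge0|exact: b_eps].
  have t2 : sd i.+2 * (r ^+ 2 * th ^+ 2 * m) <= eps * rest i.
    have mle : m <= v i.+1 / a i.+1 ^+ 2.
      rewrite ler_pdivlMr ?exprn_gt0 ?a_gt0// mulrC; exact: erw_second_moment.
    have -> : sd i.+2 * (r ^+ 2 * th ^+ 2 * m) = b i.+2 ^+ 2 / sd i.+2 * (th ^+ 2 * m).
      by rewrite /r; field; rewrite gt_eqF.
    have -> : eps * rest i = b i.+2 ^+ 2 / eps *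
        ((i.+1%:R ^+ 2)^-1 * (v i.+1 / a i.+1 ^+ 2)).
      rewrite /rest /b /eps; field.
      by rewrite !gt_eqF ?a_gt0// pnatr_eq0.
    have b2 : 0 <= b i.+2 ^+ 2 by exact: sqr_ge0.
    apply: ler_pM.
    + by rewrite divr_ge0// ltW.
    + by rewrite mulr_ge0// sqr_ge0.
    + by rewrite ler_wpM2l// lef_pV2 ?posrE// eps_sd.
    + by apply: ler_pM => //; rewrite ?sqr_ge0//; exact: drift2.
  have -> : sd i.+2 * kappa * (step_const * r ^+ 3 +
      step_const * r ^+ 2 * th ^+ 2 * m) =
    kappa * step_const * (sd i.+2 * r ^+ 3 + sd i.+2 * (r ^+ 2 * th ^+ 2 * m)).
    ring.
  have -> : kappa * eps * step_const *
      (2 * (ln (var i.+1) - ln (var i.+2)) + rest i) =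
    kappa * step_const * (eps * (2 * (ln (var i.+1) - ln (var i.+2))) +
      eps * rest i) by ring.
  by apply: ler_wpM2l; [exact: mulr_ge0|exact: lerD].
Qed.

Lemma l1_close_elephant : l1_close
  (fun x => erw_mean N (fun s => (a N.+1 / Num.sqrt (v N.+1) * s <= x)%R%:R)) Phi
  (kappa * (expR 1 + 80 + 2 * step_const) * (A / Num.sqrt (v N.+1)) *
    (1 + ln (1 + v N.+1 / A ^+ 2) +
     \sum_(i < N) a i.+2 ^+ 2 / A ^+ 2 * (v i.+1 / (a i.+1 ^+ 2 * i.+1%:R ^+ 2)))).
Proof.
have step0 : 0 <= step_const :> R by rewrite addr_ge0// mulr_ge0// expR_ge0.
have chain n : (n <= N)%N -> l1_close (D n) (D 0)
    (kappa * eps * step_const *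
      (2 * (ln (var 1) - ln (var n.+1)) + \sum_(i < n) rest i)).
  elim: n => [_|n IH nN].
    exists (fun=> 0); split => [|x|]; first exact: measurable_cst.
      by rewrite subrr normr0.
    by rewrite integral0 lee_fin subrr big_ord0 mulr0 addr0 mulr0.
  apply: l1_close_le (l1_close_trans _ _ _ _ _ (mid_step _ nN) (IH (ltnW nN))) _.
  by rewrite big_ord_recr/= le_eqVlt; apply/orP; left; apply/eqP; ring.
apply: l1_close_le (l1_close_trans _ _ _ _ _ last_step
  (l1_close_trans _ _ _ _ _ (chain N (leqnn _))
    (l1_close_trans _ _ _ _ _ first_step zeroth_step))) _.
rewrite -/rv -/eps.
set S := \sum_(i < N) _.
have S0 : 0 <= S.
  apply: sumr_ge0 => i _; rewrite mulr_ge0//.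
    by rewrite divr_ge0// sqr_ge0.
  rewrite divr_ge0//; last by rewrite mulr_ge0// sqr_ge0.
  by apply: le_trans (v_le 1 _ isT _); rewrite ?v1.
have L0 : 0 <= ln (1 + v N.+1 / A ^+ 2).
  by rewrite ln_ge0// lerDl divr_ge0 ?sqr_ge0// ltW.
(* Only the quotient of the first and last variances survives the telescoping,
   [(v N.+1 - 1 + A^2) / A^2]. *)
have L : ln (var 1) - ln (var N.+1) <= ln (1 + v N.+1 / A ^+ 2).
  rewrite -ln_div ?posrE ?var_gt0 ?leqnn// ler_ln ?posrE.
  - rewrite /var subrr add0r v1.
    rewrite ler_pdivrMr; last by rewrite divr_gt0 ?exprn_gt0.
    have -> : (1 + v N.+1 / A ^+ 2) * (A ^+ 2 / v N.+1) =
      (v N.+1 + A ^+ 2) / v N.+1.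
      by field; rewrite !gt_eqF.
    by rewrite ler_pM2r ?invr_gt0//; lra.
  - by rewrite divr_gt0// var_gt0 ?leqnn.
  - by rewrite ltr_pwDl// divr_ge0 ?sqr_ge0// ltW.
have ke : 0 <= kappa * eps by rewrite mulr_ge0// ltW.
have e1 := expR_ge0 (1 : R).
set L1 := ln (var 1) - _ in L *; set L2 := ln (1 + _) in L L0 *.
have -> : kappa * (expR 1 + 80 + 2 * step_const) * eps * (1 + L2 + S) =
  kappa * eps * ((expR 1 + 80 + 2 * step_const) * (1 + L2 + S)) by ring.
(* 80 is the 2 of [last_step] plus the 78 of [zeroth_step]. *)
have -> : kappa * eps * 2 + (kappa * eps * step_const * (2 * L1 + S) +
    (kappa * eps * expR 1 + kappa * eps * 78)) =
  kappa * eps * (expR 1 + 80 + step_const * (2 * L1 + S)) by ring.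
apply: ler_wpM2l => //.
have : step_const * (2 * L1 + S) <= step_const * (2 * L2 + S).
  by rewrite ler_wpM2l//; lra.
have := mulr_ge0 e1 L0; have := mulr_ge0 e1 S0.
have := mulr_ge0 step0 S0; have := mulr_ge0 step0 L0; lra.
Qed.

End martingale_bound.

(** * Growth of the normalizing sequences *)

Section normalizing_sequences.
Context {R : realType}.
Implicit Types (n N i : nat) (p : R).

Lemma erw_aE p n : 0 < p -> (0 < n)%N ->
  erw_a p n = Gamma n%:R * Gamma (2 * p) / Gamma (n%:R + 2 * p - 1).
Proof.
move=> p0; rewrite /erw_a; case: eqP => [->|//] _.
have G0 : 0 < Gamma (2 * p) by apply: Gamma_gt0; lra.
by rewrite Gamma1 mul1r addrAC subrr add0r divff// gt_eqF.
Qed.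

Lemma erw_a_gt0 p n : 0 < p -> (0 < n)%N -> 0 < erw_a p n.
Proof.
move=> p0 n0; rewrite erw_aE//.
have n1 : 1 <= n%:R :> R by rewrite ler1n.
by rewrite divr_gt0 ?mulr_gt0 ?Gamma_gt0//; lra.
Qed.

(** The functional equation at [n] and at [n + 2 p - 1] gives the ratio [(n + 2 p - 1) / n] of
    consecutive coefficients. *)
Lemma erw_aS p n : 0 < p -> (0 < n)%N ->
  erw_a p n.+1 * (1 + erw_drift p n) = erw_a p n.
Proof.
move=> p0 n0; have n1 : 1 <= n%:R :> R by rewrite ler1n.
have s0 : 0 < n%:R + 2 * p - 1 by lra.
rewrite !erw_aE// -[n.+1%:R]natr1 GammaS; last by lra.
rewrite (_ : n%:R + 1 + 2 * p - 1 = n%:R + 2 * p - 1 + 1); last by ring.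
have := Gamma_gt0 _ s0; rewrite GammaS// /erw_drift.
move: (Gamma _) (Gamma _) (Gamma _) => g1 g2 g3 g0.
move: (n%:R) n1 s0 => x x1 s0.
by field; rewrite !gt_eqF//; lra.
Qed.

Lemma erw_v1 p : erw_v p 1 = 1.
Proof. by rewrite /erw_v big_nat1 /erw_a eqxx expr1n. Qed.

Lemma erw_vS p n : erw_v p n.+1 = erw_v p n + erw_a p n.+1 ^+ 2.
Proof. by rewrite /erw_v big_nat_recr. Qed.

Lemma erw_v_ge0 p n : 0 <= erw_v p n.
Proof. by apply: sumr_ge0 => i _; exact: sqr_ge0. Qed.

Definition harmonic_sum n : R := \sum_(i < n) i.+1%:R^-1.

Lemma harmonic_sum_le n : (0 < n)%N -> harmonic_sum n <= 1 + ln n%:R.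
Proof.
case: n => // n _; elim: n => [|n IH].
  by rewrite /harmonic_sum big_ord1 ln1 invr1 addr0.
rewrite /harmonic_sum big_ord_recr/=.
have n0 : 0 < n.+1%:R :> R by rewrite ltr0n.
have m0 : 0 < n.+2%:R :> R by rewrite ltr0n.
have := @le_ln1Dx R (n.+1%:R / n.+2%:R - 1).
have -> : 1 + (n.+1%:R / n.+2%:R - 1) = n.+1%:R / n.+2%:R :> R by ring.
have E : n.+1%:R / n.+2%:R - 1 = - n.+2%:R^-1 :> R.
  move: n0; rewrite -[n.+2%:R]natr1; move: (n.+1%:R) => m n0.
  by field; rewrite gt_eqF//; lra.
rewrite ln_div ?posrE// E ltrN2 invf_lt1// ltr1n => /(_ isT).
rewrite -/(harmonic_sum _); move: IH.
move: (harmonic_sum _) (ln _) (ln _) (_^-1) => h l1 l2 m1; lra.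
Qed.

Lemma ln_le_harmonic_sum n : ln n%:R <= harmonic_sum n.
Proof.
suff : ln n.+1%:R <= harmonic_sum n.
  move=> h; case: n h => [|n] h; first by rewrite ln0// /harmonic_sum big_ord0.
  apply: le_trans h; rewrite ler_ln ?posrE ?ltr0n// ler_nat//.
elim: n => [|n IH]; first by rewrite ln1 /harmonic_sum big_ord0.
rewrite /harmonic_sum big_ord_recr/=.
have n0 : 0 < n.+1%:R :> R by rewrite ltr0n.
have m0 : 0 < n.+2%:R :> R by rewrite ltr0n.
have i0 : 0 < n.+1%:R^-1 :> R by rewrite invr_gt0.
have := @le_ln1Dx R n.+1%:R^-1.
have -> : 1 + n.+1%:R^-1 = n.+2%:R / n.+1%:R :> R.
  move: n0; rewrite -[n.+2%:R]natr1; move: (n.+1%:R) => m n0.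
  by field; rewrite gt_eqF.
rewrite ln_div ?posrE// => /(_ (lt_trans (ltrN10 R) i0)).
rewrite -/(harmonic_sum _); move: IH.
move: (harmonic_sum _) (ln _) (ln _) (_^-1) => h l1 l2 m1; lra.
Qed.

Lemma harmonic_sum_incr n : harmonic_sum n <= harmonic_sum n.+1.
Proof. by rewrite {2}/harmonic_sum big_ord_recr/= lerDl invr_ge0. Qed.

(** * Memory parameter below 1/2: increasing coefficients *)

Section subcritical.
Variable p : R.
Hypothesis p12 : 0 < p < 1 / 2.
Let p0 : 0 < p. Proof. by case/andP: p12. Qed.

Lemma erw_a_incr n : (0 < n)%N -> erw_a p n <= erw_a p n.+1.
Proof.
move=> n0; rewrite -(erw_aS _ _ p0 n0) ler_piMr ?(ltW (erw_a_gt0 _ _ _ _))//.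
rewrite /erw_drift gerDl; case/andP: p12 => *.
by rewrite ler_pdivrMr ?ltr0n// mul0r; lra.
Qed.

Lemma erw_a_homo i n : (0 < i)%N -> (i <= n)%N -> erw_a p i <= erw_a p n.
Proof.
move=> i0; elim: n => [|n IH]; first by rewrite leqn0 => /eqP ->.
rewrite leq_eqVlt => /predU1P[<-//|]; rewrite ltnS => ij.
by apply: (le_trans (IH ij)); apply: erw_a_incr; exact: leq_trans i0 ij.
Qed.

Lemma erw_v_le n : erw_v p n <= n%:R * erw_a p n ^+ 2.
Proof.
have -> : n%:R * erw_a p n ^+ 2 = \sum_(1 <= i < n.+1) erw_a p n ^+ 2.
  by rewrite sumr_const_nat subn1/= mulr_natl.
apply: ler_sum_nat => i /andP[i1 i2]; have n1 := leq_trans i1 i2.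
apply: lerXn2r; rewrite ?nnegrE.
- exact/ltW/erw_a_gt0.
- exact/ltW/erw_a_gt0.
- exact: erw_a_homo.
Qed.

(** From [m] to [m + 1] the left side grows by at most [3 a^2], with [a] the new coefficient, and
    the right side by exactly that: its old value is [a^2 (m + 2 p - 1)^2 / m], at least
    [a^2 (m - 2)] because [p > 0]. *)
Lemma erw_v_ge n : (0 < n)%N -> n%:R * erw_a p n ^+ 2 <= 3 * erw_v p n.
Proof.
case: n => // n _; elim: n => [|n IH].
  by rewrite erw_v1 /erw_a eqxx expr1n; lra.
rewrite erw_vS; move: IH; rewrite -(erw_aS _ n.+1)// /erw_drift.
have := erw_a_gt0 p n.+2 p0 isT; move: (erw_a p n.+2) => a a0.
rewrite -[n.+2%:R]natr1; set m := n.+1%:R; have m1 : 1 <= m by rewrite ler1n.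
have E : m * (a * (1 + (2 * p - 1) / m)) ^+ 2 =
    a ^+ 2 * ((m + (2 * p - 1)) ^+ 2 / m) by field; rewrite gt_eqF//; lra.
have : a ^+ 2 * (m - 2) <= a ^+ 2 * ((m + (2 * p - 1)) ^+ 2 / m).
  rewrite ler_wpM2l ?sqr_ge0// ler_pdivlMr; last by lra.
  by case/andP: p12 => *; nra.
rewrite -E; set X := m * _ ^+ 2; set V := erw_v p n.+1; nra.
Qed.

End subcritical.

(** * Memory parameter above 1/2: decreasing coefficients *)

Section supercritical.
Variable p : R.
Hypothesis p34 : 1 / 2 < p <= 3 / 4.
Let p0 : 0 < p. Proof. by case/andP: p34 => *; lra. Qed.
Let drift_gt0 n : (0 < n)%N -> 0 < erw_drift p n.
Proof. by move=> n0; rewrite divr_gt0 ?ltr0n//; case/andP: p34 => *; lra. Qed.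

Lemma erw_a_decr n : (0 < n)%N -> erw_a p n.+1 <= erw_a p n.
Proof.
move=> n0; rewrite -(erw_aS _ _ p0 n0) ler_peMr ?(ltW (erw_a_gt0 _ _ _ _))//.
by rewrite lerDl ltW// drift_gt0.
Qed.

Lemma erw_a_nhomo i n : (0 < i)%N -> (i <= n)%N -> erw_a p n <= erw_a p i.
Proof.
move=> i0; elim: n => [|n IH]; first by rewrite leqn0 => /eqP ->.
rewrite leq_eqVlt => /predU1P[<-//|]; rewrite ltnS => ij.
by apply: le_trans (IH ij); apply: erw_a_decr; exact: leq_trans i0 ij.
Qed.

Lemma erw_a_le1 n : (0 < n)%N -> erw_a p n <= 1.
Proof. by move=> n0; have := erw_a_nhomo 1 n isT n0; rewrite {2}/erw_a eqxx. Qed.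

Lemma erw_v_len n : erw_v p n <= n%:R.
Proof.
apply: le_trans (_ : \sum_(1 <= i < n.+1) 1 <= _); last first.
  by rewrite sumr_const_nat subn1.
apply: ler_sum_nat => i /andP[i1 i2].
by rewrite expr_le1// ?erw_a_le1// ltW// erw_a_gt0.
Qed.

(** Each factor [1 / (1 + t)] of the coefficient is at least [exp (- t)], and the drifts [t] sum to
    a multiple of the harmonic sum. *)
Lemma erw_a_ge n : expR (- ((2 * p - 1) * harmonic_sum n)) <= erw_a p n.+1.
Proof.
elim: n => [|n IH].
  by rewrite /harmonic_sum big_ord0 mulr0 oppr0 expR0 /erw_a eqxx.
have d0 := drift_gt0 n.+1 isT.
have -> : erw_a p n.+2 = erw_a p n.+1 * (1 + erw_drift p n.+1)^-1.
  by rewrite -(erw_aS _ n.+1)// mulfK// gt_eqF//; lra.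
have -> : - ((2 * p - 1) * harmonic_sum n.+1) =
    - ((2 * p - 1) * harmonic_sum n) + - erw_drift p n.+1.
  by rewrite {1}/harmonic_sum big_ord_recr/= -/(harmonic_sum n) /erw_drift; ring.
rewrite expRD ler_pM ?expR_ge0// expRN lef_pV2 ?posrE ?expR_gt0 ?expR_ge1Dx//.
lra.
Qed.

(** Bounding the harmonic sum by [1 + ln n] costs a factor [exp (4 p - 2)], at most [e] since
    [p <= 3 / 4], and [e <= 4]. *)
Lemma erw_a2_ge n : (0 < n)%N -> n%:R `^ (2 - 4 * p) <= 4 * erw_a p n ^+ 2.
Proof.
case: n => // n _.
have h := harmonic_sum_le n.+1 isT; have h' := harmonic_sum_incr n.
set l := ln n.+1%:R in h; have [q0 q1] : 0 < 2 * p - 1 /\ 2 * p - 1 <= 1 / 2.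
  by case/andP: p34 => *; split; lra.
have -> : n.+1%:R `^ (2 - 4 * p) = expR ((2 - 4 * p) * l) :> R.
  by rewrite /powR pnatr_eq0.
have e4 : 1 <= 4 * expR (- 1 : R).
  have -> : expR (- 1 : R) = expR (- 2^-1) ^+ 2.
    by rewrite -expRM_natl; congr expR; field.
  by have := expR_ge1Dx (- 2^-1 : R); nra.
have : expR (- ((2 * p - 1) * harmonic_sum n)) ^+ 2 <= erw_a p n.+1 ^+ 2.
  rewrite lerXn2r ?nnegrE ?expR_ge0 ?erw_a_ge//.
  by rewrite ltW// erw_a_gt0.
rewrite -expRM_natl => H.
have : expR ((2 - 4 * p) * l - 1) <= erw_a p n.+1 ^+ 2.
  by apply: le_trans H; rewrite ler_expR; nra.
rewrite expRD; have := expR_ge0 ((2 - 4 * p) * l); nra.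
Qed.

Lemma erw_v_gen n : (0 < n)%N -> n%:R `^ (3 - 4 * p) <= 4 * erw_v p n.
Proof.
move=> n0; have nn : n%:R != 0 :> R by rewrite pnatr_eq0 -lt0n.
have -> : 3 - 4 * p = 1 + (2 - 4 * p) by ring.
rewrite powRD ?nn ?implybT// powRr1//.
apply: le_trans (_ : n%:R * (4 * erw_a p n ^+ 2) <= _).
  by rewrite ler_wpM2l// erw_a2_ge.
rewrite mulrCA ler_wpM2l// /erw_v.
have -> : n%:R * erw_a p n ^+ 2 = \sum_(1 <= i < n.+1) erw_a p n ^+ 2.
  by rewrite sumr_const_nat subn1/= mulr_natl.
apply: ler_sum_nat => i /andP[i1 i2].
apply: lerXn2r; rewrite ?nnegrE.
- exact/ltW/erw_a_gt0.
- exact/ltW/erw_a_gt0.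
- exact: erw_a_nhomo.
Qed.

End supercritical.

(** * Memory parameter 3/4: logarithmic variance *)

Section critical.
Let p : R := 3 / 4.
Let p34 : 1 / 2 < p <= 3 / 4. Proof. by rewrite /p; apply/andP; split; lra. Qed.
Let p0 : 0 < p. Proof. by rewrite /p; lra. Qed.

(** [(1 + 1 / (2 m))^2 m = m + 1 + 1 / (4 m)] exceeds [m + 1], so the squared coefficients decrease
    at least as fast as [1 / n]. *)
Lemma erw_a2_le_crit n : erw_a p n.+1 ^+ 2 <= n.+1%:R^-1.
Proof.
elim: n => [|n IH]; first by rewrite /erw_a eqxx expr1n invr1.
move: IH; rewrite -(erw_aS _ n.+1)// /erw_drift exprMn.
rewrite -[n.+2%:R]natr1; set m := n.+1%:R; have m1 : 1 <= m by rewrite ler1n.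
have m0 : 0 < m by lra.
have -> : 2 * p - 1 = 1 / 2 by rewrite /p; lra.
have := sqr_ge0 (erw_a p n.+2); move: (_ ^+ 2) => a a0 h.
rewrite -[leRHS]mul1r ler_pdivlMr; last lra.
have {}h : a * (1 + 1 / 2 / m) ^+ 2 * m <= 1 by rewrite -ler_pdivlMr// [leRHS]mul1r.
apply: le_trans h; rewrite -mulrA ler_wpM2l//.
have -> : (1 + 1 / 2 / m) ^+ 2 * m = m + 1 + (1 / 4) / m by field; rewrite gt_eqF.
by rewrite lerDl divr_ge0 ?(ltW m0)//; lra.
Qed.

Lemma erw_v_le_crit n : (0 < n)%N -> erw_v p n <= 1 + ln n%:R.
Proof.
move=> n0; apply: le_trans (harmonic_sum_le _ n0).
rewrite /erw_v big_add1/= big_mkord; apply: ler_sum => i _.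
exact: erw_a2_le_crit.
Qed.

Lemma erw_v_ge_crit n : ln n%:R <= 4 * erw_v p n.
Proof.
apply: le_trans (ln_le_harmonic_sum n) _.
rewrite /erw_v big_add1/= big_mkord mulr_sumr; apply: ler_sum => i _.
have := erw_a2_ge p p34 i.+1 isT.
by rewrite (_ : 2 - 4 * p = - 1) ?powR_inv1// /p; lra.
Qed.

(** With [v] logarithmic the series converges, so the variance defects contribute no logarithm. The
    induction subtracts [(v n + 1) / n], which bounds the tail after [n]; the constant 3 makes
    [n = 1] an equality. *)
Lemma erw_sum_crit n :
  \sum_(i < n) erw_v p i.+1 / i.+1%:R ^+ 2 <= 3.
Proof.
case: n => [|n]; first by rewrite big_ord0.
suff H : \sum_(i < n.+1) erw_v p i.+1 / i.+1%:R ^+ 2 <=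
    3 - (erw_v p n.+1 + 1) / n.+1%:R.
  apply: le_trans H _; rewrite gerBl divr_ge0// addr_ge0//.
  exact: erw_v_ge0.
elim: n => [|n IH].
  by rewrite big_ord1 erw_v1 expr1n; lra.
rewrite big_ord_recr/=; move: IH; set S := \sum_(i < n.+1) _ => IH.
have hv := erw_vS p n.+1; have ha := erw_a2_le_crit n.+1.
have v0 := erw_v_ge0 p n.+2.
move: IH hv ha v0; rewrite -[n.+2%:R]natr1.
set m := n.+1%:R; set v' := erw_v p n.+2; set v := erw_v p n.+1.
have m1 : 1 <= m by rewrite ler1n.
move=> IH hv ha v0; have m0 : 0 < m by lra.
have k0 : 0 < m + 1 by lra.
apply: le_trans (_ : 3 - (v + 1) / m + v' / (m + 1) ^+ 2 <= _).
  by rewrite lerD2r.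
have h1 : v' - (m + 1)^-1 <= v by lra.
have h2 : (v' - (m + 1)^-1 + 1) / m <= (v + 1) / m.
  by rewrite ler_pM2r ?invr_gt0// lerD2r.
have h3 : v' / (m + 1) ^+ 2 <= v' / (m * (m + 1)).
  rewrite ler_wpM2l// lef_pV2 ?posrE ?exprn_gt0 ?mulr_gt0//; nra.
have E : (v' - (m + 1)^-1 + 1) / m = (v' + 1) / (m + 1) + v' / (m * (m + 1)).
  by field; rewrite !gt_eqF.
move: h2 h3; rewrite E.
move: (_ / (m * (m + 1))) (_ / (m + 1) ^+ 2) (_ / (m + 1)) (_ / m).
by move=> x1 x2 x3 x4; lra.
Qed.

End critical.

End normalizing_sequences.

(** * Rates in the three regimes *)

Section wasserstein_bounds.
Context {R : realType}.
Implicit Types (p q : R) (n : nat).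

Definition lindeberg_const : R :=
  Num.sqrt (8 * pi) * (expR 1 + 80 + 2 * step_const).

Lemma lindeberg_const_gt0 : 0 < lindeberg_const.
Proof.
have e0 := expR_gt0 (1 : R).
by rewrite mulr_gt0 ?sqrtr_gt0 ?mulr_gt0 ?pi_gt0// /step_const; lra.
Qed.

Lemma wasserstein1_normal_le (d : measure_display) (T : measurableType d)
    (P : probability T R) (X : {RV P >-> R}) (F : R -> R) (c : R) :
  (forall x, cdf X x = (F x)%:E) -> l1_close F Phi c ->
  (wasserstein1_normal X <= c%:E)%E.
Proof.
move=> FX [h [mh Fh ih]].
have mPhi : measurable_fun setT (@Phi R).
  apply: continuous_measurable_fun => x.
  exact: is_derive_continuous (is_derive_Phi x).
have mF : measurable_fun setT F.
  apply/measurable_EFinP; rewrite (_ : _ \o _ = cdf X).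
    exact: cdf_measurable.
  by apply/funext => x /=; rewrite FX.
apply: le_trans ih; rewrite /wasserstein1_normal.
under eq_integral do rewrite FX std_normal_cdfE -EFinB abse_EFin.
apply: ge0_le_integral => //.
- apply/measurable_EFinP; apply: measurableT_comp => //.
  exact: measurable_funB.
- exact/measurable_EFinP.
- by move=> x _; rewrite lee_fin.
Qed.

(** The expression in [l1_close_elephant] without its numerical constant; there [n] is [N.+1], hence
    the [n.-1] summands. *)
Definition lindeberg_bound p n (A : R) : R :=
  A / Num.sqrt (erw_v p n) *
    (1 + ln (1 + erw_v p n / A ^+ 2) +
     \sum_(i < n.-1) erw_a p i.+2 ^+ 2 / A ^+ 2 *
       (erw_v p i.+1 / (erw_a p i.+1 ^+ 2 * i.+1%:R ^+ 2))).

Lemma wasserstein1_erw_le p q (d : measure_display) (T : measurableType d)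
    (P : probability T R) (alpha : nat -> {RV P >-> R})
    (beta : nat -> {RV P >-> nat}) (eta : nat -> {RV P >-> R}) n (A : R) :
  0 < p <= 1 -> 0 <= q <= 1 -> elephant_random_walk p q alpha beta eta ->
  (0 < n)%N -> 0 < A -> (forall i, (0 < i <= n)%N -> erw_a p i <= A) ->
  A ^+ 2 <= erw_v p n ->
  (wasserstein1_normal (erw_normalized p eta n)
    <= (lindeberg_const * lindeberg_bound p n A)%:E)%E.
Proof.
move=> /andP[p0 p1] q01 erw; case: n => // n _ A0 aA Av.
have p01 : 0 <= p <= 1 by rewrite ltW.
apply: wasserstein1_normal_le (cdf_erw_normalized _ _ _ _ _ _ erw n) _.
rewrite /lindeberg_bound /lindeberg_const mulrA.
apply: l1_close_elephant => //.
- by move=> k k0; exact: erw_a_gt0.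
- by move=> k k0; exact: erw_aS.
- exact: erw_v1.
- by move=> k _; exact: erw_vS.
Qed.

Let sqr_ratio_le1 (x y : R) : 0 < x -> x <= y -> x ^+ 2 / y ^+ 2 <= 1.
Proof.
move=> x0 xy; have y0 := lt_le_trans x0 xy.
by rewrite ler_pdivrMr ?exprn_gt0// mul1r lerXn2r ?nnegrE ?(ltW x0) ?(ltW y0).
Qed.

Let quot_ge0 p i : 0 <= erw_v p i.+1 / (erw_a p i.+1 ^+ 2 * i.+1%:R ^+ 2).
Proof.
by apply: divr_ge0; [exact: erw_v_ge0|apply: mulr_ge0; exact: sqr_ge0].
Qed.

Let sum_terms_ge0 p n (A : R) :
  0 <= \sum_(i < n) erw_a p i.+2 ^+ 2 / A ^+ 2 *
    (erw_v p i.+1 / (erw_a p i.+1 ^+ 2 * i.+1%:R ^+ 2)).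
Proof.
apply: sumr_ge0 => i _; apply: mulr_ge0 (quot_ge0 p i).
by apply: divr_ge0; exact: sqr_ge0.
Qed.

Let half_le_ln n : (2 <= n)%N -> 1 <= 2 * ln n%:R :> R.
Proof.
move=> n2; apply: le_trans (le_2ln1Dx 1 _ _) _ => //.
rewrite ler_wpM2l// ler_ln ?posrE//.
- by rewrite (_ : 1 + 1 = 2%:R)// ler_nat.
- by rewrite ltr0n (leq_trans _ n2).
Qed.

Let ln1n_le n : (2 <= n)%N -> ln (1 + n%:R) <= 2 * ln n%:R :> R.
Proof.
move=> n2; have n0 : 0 < n%:R :> R by rewrite ltr0n (leq_trans _ n2).
have n2' : 2 <= n%:R :> R by rewrite ler_nat.
have -> : 2 * ln n%:R = ln (n%:R ^+ 2) :> R by rewrite lnXn// mulr_natl.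
by rewrite ler_ln ?posrE ?exprn_gt0 ?addr_gt0//; nra.
Qed.

(** 7 is 2 + 2 + 3: for [n >= 2], both 1 and [ln (1 + n)] are at most [2 ln n], and the harmonic sum
    is at most [1 + ln n]. *)
Let sum_log_le n (s : R) : (2 <= n)%N -> s <= harmonic_sum n.-1 ->
  1 + ln (1 + n%:R) + s <= 7 * ln n%:R.
Proof.
move=> n2 hs; have n0 : (0 < n)%N by exact: leq_trans n2.
have h1 := half_le_ln n n2; have h2 := ln1n_le n n2.
have h3 := harmonic_sum_le (R := R) n n0.
have h4 := harmonic_sum_incr (R := R) n.-1; rewrite prednK// in h4.
by move: (ln _) (ln _) (harmonic_sum _) (harmonic_sum _) h1 h2 h3 h4 hs
  => a b c e; lra.
Qed.

(** [v i <= i a_i^2] makes each summand at most [1 / i], and [n a_n^2 <= 3 v n] bounds the prefactor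
    by [2 / sqrt n]; 14 is 2 times 7. *)
Lemma lindeberg_bound_subcritical p n : 0 < p < 1 / 2 -> (2 <= n)%N ->
  lindeberg_bound p n (erw_a p n) <= 14 * (ln n%:R / Num.sqrt n%:R).
Proof.
move=> p12 n2; have n0 : (0 < n)%N by exact: leq_trans n2.
have p0 : 0 < p by case/andP: p12.
have n0' : 0 < n%:R :> R by rewrite ltr0n.
have a0 := erw_a_gt0 p n p0 n0.
have vle := erw_v_le p p12 n; have vge := erw_v_ge p p12 n n0.
rewrite /lindeberg_bound; set S := \sum_(i < _) _.
have v0 : 0 < erw_v p n.
  have : 0 < n%:R * erw_a p n ^+ 2 by rewrite mulr_gt0 ?exprn_gt0.
  lra.
have S1 : S <= harmonic_sum n.-1.
  apply: ler_sum => i _.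
  have in' : (i.+2 <= n)%N by have := ltn_ord i; rewrite -ltnS prednK.
  have ai0 := erw_a_gt0 p i.+1 p0 isT.
  rewrite -[leRHS]mul1r; apply: ler_pM.
  - by apply: divr_ge0; exact: sqr_ge0.
  - exact: quot_ge0.
  - apply: sqr_ratio_le1; [exact: erw_a_gt0|exact: erw_a_homo].
  - rewrite ler_pdivrMr ?mulr_gt0 ?exprn_gt0//.
    apply: le_trans (erw_v_le p p12 i.+1) _.
    rewrite le_eqVlt; apply/orP; left; apply/eqP.
    have : i.+1%:R != 0 :> R by rewrite pnatr_eq0.
    by move: (i.+1%:R) => m m0; field.
have L : ln (1 + erw_v p n / erw_a p n ^+ 2) <= ln (1 + n%:R).
  rewrite ler_ln ?posrE ?ltr_pwDl ?divr_ge0 ?sqr_ge0 ?(ltW v0)//.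
  by rewrite lerD2l ler_pdivrMr ?exprn_gt0.
have B : erw_a p n / Num.sqrt (erw_v p n) <= 2 / Num.sqrt n%:R.
  rewrite ler_pdivrMr ?sqrtr_gt0// mulrAC ler_pdivlMr ?sqrtr_gt0//.
  rewrite -(@ler_pXn2r _ 2)// ?nnegrE ?mulr_ge0 ?sqrtr_ge0 ?(ltW a0)//.
  by rewrite !exprMn !sqr_sqrtr ?(ltW v0) ?(ltW n0')//; lra.
have T : 1 + ln (1 + erw_v p n / erw_a p n ^+ 2) + S <= 7 * ln n%:R.
  by apply: le_trans (sum_log_le n S n2 S1); rewrite lerD2r lerD2l.
have -> : 14 * (ln n%:R / Num.sqrt n%:R) = 2 / Num.sqrt n%:R * (7 * ln n%:R) :> R.
  by ring.
apply: ler_pM => //; first by rewrite divr_ge0 ?sqrtr_ge0// ltW.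
rewrite !addr_ge0//.
  by rewrite ln_ge0// lerDl divr_ge0 ?sqr_ge0// ltW.
exact: sum_terms_ge0.
Qed.

Let supercritical_term_le p i : 1 / 2 < p <= 3 / 4 ->
  erw_a p i.+2 ^+ 2 / 1 ^+ 2 *
    (erw_v p i.+1 / (erw_a p i.+1 ^+ 2 * i.+1%:R ^+ 2)) <=
  erw_v p i.+1 / i.+1%:R ^+ 2.
Proof.
move=> p34; have p0 : 0 < p by case/andP: p34 => *; lra.
have a1 := erw_a_gt0 p i.+1 p0 isT; have a2 := erw_a_gt0 p i.+2 p0 isT.
have v0 := erw_v_ge0 p i.+1.
have m0 : 0 < i.+1%:R :> R by rewrite ltr0n.
have h : erw_a p i.+2 ^+ 2 / erw_a p i.+1 ^+ 2 <= 1.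
  by apply: sqr_ratio_le1 a2 _; exact: erw_a_decr.
have -> : erw_a p i.+2 ^+ 2 / 1 ^+ 2 *
    (erw_v p i.+1 / (erw_a p i.+1 ^+ 2 * i.+1%:R ^+ 2)) =
    erw_a p i.+2 ^+ 2 / erw_a p i.+1 ^+ 2 * (erw_v p i.+1 / i.+1%:R ^+ 2).
  move: (erw_a p i.+1) (erw_a p i.+2) (erw_v p i.+1) (i.+1%:R) a1 a2 m0 {v0 h}.
  by move=> x y v m x0 y0 m0; field; rewrite !gt_eqF.
by rewrite ler_piMl// divr_ge0// sqr_ge0.
Qed.

Let super_scale_le (v y : R) : 0 < y -> y <= 4 * v ->
  1 / Num.sqrt v <= 2 / Num.sqrt y.
Proof.
move=> y0 yv; have v0 : 0 < v by lra.
rewrite ler_pdivrMr ?sqrtr_gt0// mulrAC ler_pdivlMr ?sqrtr_gt0// mul1r.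
rewrite -(@ler_pXn2r _ 2)// ?nnegrE ?mulr_ge0 ?sqrtr_ge0//.
by rewrite !exprMn !sqr_sqrtr ?(ltW v0) ?(ltW y0)//; lra.
Qed.

(** The crude [v i <= i] already makes each summand at most [1 / i], with a constant that does not
    involve [p]. *)
Lemma lindeberg_bound_supercritical p n : 1 / 2 < p < 3 / 4 -> (2 <= n)%N ->
  lindeberg_bound p n 1 <= 14 * (ln n%:R / Num.sqrt (n%:R `^ (3 - 4 * p))).
Proof.
move=> /andP[p1 p2] n2; have n0 : (0 < n)%N by exact: leq_trans n2.
have p34 : 1 / 2 < p <= 3 / 4 by rewrite p1 ltW.
have p0 : 0 < p by lra.
have n0' : 0 < n%:R :> R by rewrite ltr0n.
have vge := erw_v_gen p p34 n n0; have vle := erw_v_len p p34 n.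
have y0 : 0 < n%:R `^ (3 - 4 * p) by exact: powR_gt0.
have v0 : 0 < erw_v p n by lra.
have B := super_scale_le _ _ y0 vge.
rewrite /lindeberg_bound expr1n divr1.
set S := \sum_(i < _) _.
have S1 : S <= harmonic_sum n.-1.
  apply: ler_sum => i _; have := supercritical_term_le p i p34.
  rewrite expr1n => h; apply: le_trans h _.
  rewrite ler_pdivrMr ?exprn_gt0 ?ltr0n//.
  apply: le_trans (erw_v_len p p34 i.+1) _.
  by rewrite expr2 mulrA mulVf ?mul1r// pnatr_eq0.
have T : 1 + ln (1 + erw_v p n) + S <= 7 * ln n%:R.
  apply: le_trans (sum_log_le n S n2 S1); rewrite lerD2r lerD2l.
  by rewrite ler_ln ?posrE ?lerD2l// addr_gt0.
set sy := Num.sqrt (n%:R `^ _) in B *.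
have -> : 14 * (ln n%:R / sy) = 2 / sy * (7 * ln n%:R) :> R by ring.
apply: ler_pM => //.
have S0 : 0 <= S.
  by have := sum_terms_ge0 p n.-1 1; rewrite /S expr1n.
by rewrite !addr_ge0// ln_ge0// lerDl ltW.
Qed.

(** Makes [ln (ln 3)] positive, so that multiples of it absorb constants in the critical case. From
    [5 / 6 <= exp (- 1 / 6)] follows [e <= (6 / 5)^6 < 3]. *)
Lemma ln3_gt1 : 1 < ln 3 :> R.
Proof.
have e0 := expR_gt0 (1 : R).
have h : expR 1 < 3 :> R.
  have h6 : 5 / 6 <= expR (- (6^-1)) :> R.
    by apply: le_trans (expR_ge1Dx _); lra.
  have : (5 / 6) ^+ 6 <= expR (- (6^-1)) ^+ 6 :> R.
    by rewrite lerXn2r ?nnegrE ?expR_ge0//; lra.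
  rewrite -expRM_natl (_ : 6%:R * - 6^-1 = - 1); last by field.
  rewrite expRN => k.
  have {}k : (5 / 6) ^+ 6 * expR 1 <= 1 :> R by rewrite -ler_pdivlMr// mul1r.
  lra.
by rewrite -ltr_expR lnK ?posrE.
Qed.

(** The outer 2 is that of [super_scale_le]. The numerator collects the 1, the bound 3 on the sum,
    and the [ln 3] from [1 + v n <= 3 ln n]; dividing by [ln (ln 3)] turns it into a multiple of
    [ln (ln n)]. *)
Definition critical_const : R := 2 * (1 + (4 + ln 3) / ln (ln 3)).

Lemma critical_const_gt0 : 0 < critical_const.
Proof.
have h := ln3_gt1; have k : 0 < ln (ln 3) :> R by rewrite ln_gt0.
have : 0 < (4 + ln 3) / ln (ln 3) :> R by rewrite divr_gt0//; lra.
by rewrite /critical_const; lra.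
Qed.

Lemma lindeberg_bound_critical n : (3 <= n)%N ->
  lindeberg_bound (3 / 4) n 1 <=
  critical_const * (ln (ln n%:R) / Num.sqrt (ln n%:R)).
Proof.
move=> n3; have n0 : (0 < n)%N by exact: leq_trans n3.
set p : R := 3 / 4.
have p34 : 1 / 2 < p <= 3 / 4 by rewrite /p; apply/andP; split; lra.
have n0' : 0 < n%:R :> R by rewrite ltr0n.
have n3' : 3 <= n%:R :> R by rewrite ler_nat.
have y3 : ln 3 <= ln n%:R :> R by rewrite ler_ln ?posrE.
have l3 := ln3_gt1.
have vge := erw_v_ge_crit (R := R) n; have vle := erw_v_le_crit (R := R) n n0.
rewrite -/p in vge vle.
rewrite /lindeberg_bound expr1n divr1; move: y3 vge vle; set y := ln n%:R.
move=> y3 vge vle; have y0 : 0 < y by lra.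
have v0 : 0 < erw_v p n by lra.
have B := super_scale_le _ _ y0 vge.
set S := \sum_(i < _) _.
have S1 : S <= 3.
  apply: le_trans (erw_sum_crit (R := R) n.-1); apply: ler_sum => i _.
  by have := supercritical_term_le p i p34; rewrite expr1n.
have S0 : 0 <= S.
  by have := sum_terms_ge0 p n.-1 1; rewrite /S expr1n.
have ll3 : 0 < ln (ln 3) :> R by rewrite ln_gt0.
have lly : ln (ln 3) <= ln y by rewrite ler_ln ?posrE//; lra.
have L : ln (1 + erw_v p n) <= ln 3 + ln y.
  by rewrite -lnM ?posrE// ler_ln ?posrE//; nra.
have T : 1 + ln (1 + erw_v p n) + S <= (1 + (4 + ln 3) / ln (ln 3)) * ln y.
  have : (4 + ln 3) / ln (ln 3) * ln (ln 3) <= (4 + ln 3) / ln (ln 3) * ln y.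
    by rewrite ler_wpM2l// divr_ge0 ?(ltW ll3)//; lra.
  rewrite divfK ?gt_eqF//; lra.
have -> : critical_const * (ln y / Num.sqrt y) =
    2 / Num.sqrt y * ((1 + (4 + ln 3) / ln (ln 3)) * ln y).
  by rewrite /critical_const; ring.
apply: ler_pM => //.
by rewrite !addr_ge0// ln_ge0// lerDl ltW.
Qed.

End wasserstein_bounds.

Theorem theorem1p1 (R : realType) :
  exists (C : R) (Cp : R -> R),
    0 < C /\ (forall p : R, 0 < Cp p) /\
    forall (p q : R), 0 <= p <= 1 -> 0 <= q <= 1 ->
    forall (d : measure_display) (T : measurableType d) (P : probability T R)
      (alpha : nat -> {RV P >-> R}) (beta : nat -> {RV P >-> nat})
      (eta : nat -> {RV P >-> R}),
    elephant_random_walk p q alpha beta eta ->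
    [/\ 0 < p < 1 / 2 -> forall n : nat, (2 <= n)%N ->
          (wasserstein1_normal (erw_normalized p eta n)
            <= (C * (ln n%:R / Num.sqrt n%:R))%:E)%E,
        1 / 2 < p < 3 / 4 -> forall n : nat, (2 <= n)%N ->
          (wasserstein1_normal (erw_normalized p eta n)
            <= (Cp p * (ln n%:R / Num.sqrt (n%:R `^ (3 - 4 * p))))%:E)%E
      & p = 3 / 4 -> forall n : nat, (3 <= n)%N ->
          (wasserstein1_normal (erw_normalized p eta n)
            <= (C * (ln (ln n%:R) / Num.sqrt (ln n%:R)))%:E)%E].
Proof.
have K0 := @lindeberg_const_gt0 R; have c0 := @critical_const_gt0 R.
pose C : R := lindeberg_const * (14 + critical_const).
have C0 : 0 < C by rewrite mulr_gt0//; lra.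
have CE (k x : R) : 0 <= x -> k <= 14 + critical_const ->
    lindeberg_const * (k * x) <= C * x.
  by move=> x0 k14; rewrite mulrA ler_wpM2r// ler_pM2l.
(* The constant of the second case can be taken uniform in [p]. *)
exists C, (fun=> C); split => //; split => // p q p01 q01 d T P alpha beta eta erw.
have main n (A B : R) : 0 < p -> (0 < n)%N -> 0 < A ->
    (forall i, (0 < i <= n)%N -> erw_a p i <= A) -> A ^+ 2 <= erw_v p n ->
    lindeberg_const * lindeberg_bound p n A <= B ->
    (wasserstein1_normal (erw_normalized p eta n) <= B%:E)%E.
  move=> p0 n0 A0 aA Av AB.
  have p01' : 0 < p <= 1 by rewrite p0; case/andP: p01.
  apply: le_trans (wasserstein1_erw_le _ _ _ _ _ _ _ _ _ _ p01' q01 erw n0 A0 aA Av) _.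
  by rewrite lee_fin.
have v_ge1 n : (0 < n)%N -> 1 ^+ 2 <= erw_v p n.
  case: n => // n _; rewrite expr1n; elim: n => [|n IH]; first by rewrite erw_v1.
  by rewrite erw_vS (le_trans IH)// lerDl sqr_ge0.
have ln_ge n : (0 < n)%N -> 0 <= ln n%:R :> R.
  by move=> n0; rewrite ln_ge0// ler1n.
split=> [p12|p34|p34] n n2.
- have n0 : (0 < n)%N by exact: leq_trans n2.
  have p0 : 0 < p by case/andP: p12.
  apply: (main _ (erw_a p n) _ p0 n0 (erw_a_gt0 p n p0 n0)).
  + by move=> i /andP[i0 ile]; exact: erw_a_homo.
  + by case: n n0 {n2} => // n _; rewrite erw_vS lerDr; apply: sumr_ge0 => j _;
      exact: sqr_ge0.
  + apply: le_trans (CE 14 _ _ _).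
    * by rewrite ler_pM2l// lindeberg_bound_subcritical.
    * by rewrite divr_ge0 ?sqrtr_ge0 ?ln_ge.
    * by lra.
- have n0 : (0 < n)%N by exact: leq_trans n2.
  have p0 : 0 < p by case/andP: p34 => *; lra.
  have p34' : 1 / 2 < p <= 3 / 4 by case/andP: p34 => -> /ltW ->.
  apply: (main _ 1) => //.
  + by move=> i /andP[i0 _]; exact: erw_a_le1.
  + exact: v_ge1.
  + apply: le_trans (CE 14 _ _ _).
    * by rewrite ler_pM2l// lindeberg_bound_supercritical.
    * by rewrite divr_ge0 ?sqrtr_ge0 ?ln_ge.
    * by lra.
- have n0 : (0 < n)%N by exact: leq_trans n2.
  have p0 : 0 < p by rewrite p34; lra.
  have p34' : 1 / 2 < p <= 3 / 4 by rewrite p34; apply/andP; split; lra.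
  apply: (main _ 1) => //.
  + by move=> i /andP[i0 _]; exact: erw_a_le1.
  + exact: v_ge1.
  + apply: le_trans (CE critical_const _ _ _).
    * by rewrite ler_pM2l// p34 lindeberg_bound_critical.
    * rewrite divr_ge0 ?sqrtr_ge0// ln_ge0// (le_trans (ltW (@ln3_gt1 R)))//.
      by rewrite ler_ln ?posrE ?ltr0n// ler_nat.
    * by lra.
Qed.
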